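(* Let $G=(V,E,w)$ be a simple, connected, undirected graph with positive edge lengths $w$, and let $s,t\in V$, with $n=|V|$, $m=|E|$. If $d_s(v)=d(s,v)$ and $d_t(v)=d(v,t)$ are given for all $v\in V$, then the optimal outward path problem for $(G,s,t)$ can be solved in $O(m+n)$ time.
   Context: A path is always a simple path (no repeated vertex); an $st$-path is a simple path from $s$ to $t$. The length of a path is the sum of the lengths of its edges, and $d(x,y)$ denotes the shortest path length between $x$ and $y$ in $G$. Let $D$ be the subgraph of $G$ formed by the union of all shortest $st$-paths. The optimal outward path problem asks for an $st$-path of minimum length among all $st$-paths containing at least one edge of $E\setminus E(D)$ (or to report that none exists). *)

(* Defs.v *)
From HB Require Import structures.
From mathcomp Require Import all_boot all_order all_algebra.
From mathcomp Require Export reals.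
Set Implicit Arguments. Unset Strict Implicit. Unset Printing Implicit Defensive.
Import Order.TTheory GRing.Theory Num.Theory.
Local Open Scope ring_scope.

(* Graphs: vertices 'I_n, adjacency e (symmetric, irreflexive = simple   *)
(* undirected), edge lengths w.                                         *)
Section Graphs.
Variables (R : realType) (T : finType) (e : rel T) (w : T -> T -> R).

Definition stpath (x y : T) (p : seq T) : bool :=
  if p is a :: q then [&& a == x, path e a q, last a q == y & uniq p]
  else false.

Definition psteps (p : seq T) : seq (T * T) := zip p (behead p).

Definition plen (p : seq T) : R := \sum_(ab <- psteps p) w ab.1 ab.2.

Definition pedge (p : seq T) (x y : T) : bool :=
  ((x, y) \in psteps p) || ((y, x) \in psteps p).

Definition is_dist (x y : T) (r : R) : Prop :=
  (exists2 p, stpath x y p & plen p = r) /\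
  (forall q, stpath x y q -> r <= plen q).

Definition shortest (x y : T) (p : seq T) : Prop :=
  stpath x y p /\ forall q, stpath x y q -> plen p <= plen q.

Definition inD (s t x y : T) : Prop :=
  exists p, shortest s t p /\ pedge p x y.

Definition outward (s t : T) (p : seq T) : Prop :=
  stpath s t p /\ exists x y, e x y /\ pedge p x y /\ ~ inD s t x y.

Definition opt_outward (s t : T) (p : seq T) : Prop :=
  outward s t p /\ forall q, outward s t q -> plen p <= plen q.

End Graphs.

Definition nedges (n : nat) (e : rel 'I_n) : nat :=
  #|[set xy : 'I_n * 'I_n | e xy.1 xy.2 && (xy.1 < xy.2)%N]|.

(* Machine model: a real RAM.  Two unbounded memories, one of natural    *)
(* numbers (addresses/integers) and one of reals; each instruction costs *)
(* one step.  Integer operations: constants, +, truncated -, indirect    *)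
(* load/store, comparison-jump.  Real operations: indirect load/store,   *)
(* +, -, comparison-jump.  (No multiplication, no real->int conversion.) *)
Inductive instr :=
| NConst (d k : nat)
| NAdd (d a b : nat)
| NSub (d a b : nat)
| NLoad (d a : nat)
| NStore (a b : nat)
| NJle (a b l : nat)
| RLoad (d a : nat)
| RStore (a b : nat)
| RAdd (d a b : nat)
| RSub (d a b : nat)
| RJle (a b l : nat)
| Halt.

Record mstate (R : realType) := MState {
  pc : nat; nmem : nat -> nat; rmem : nat -> R }.

Definition upd {V : Type} (f : nat -> V) (a : nat) (v : V) : nat -> V :=
  fun i => if i == a then v else f i.

Definition step (R : realType) (P : seq instr) (st : mstate R)
  : option (mstate R) :=
  let: MState c N X := st in
  match nth Halt P c with
  | NConst d k => Some (MState c.+1 (upd N d k) X)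
  | NAdd d a b => Some (MState c.+1 (upd N d (N a + N b)%N) X)
  | NSub d a b => Some (MState c.+1 (upd N d (N a - N b)%N) X)
  | NLoad d a => Some (MState c.+1 (upd N d (N (N a))) X)
  | NStore a b => Some (MState c.+1 (upd N (N a) (N b)) X)
  | NJle a b l => Some (MState (if (N a <= N b)%N then l else c.+1) N X)
  | RLoad d a => Some (MState c.+1 N (upd X d (X (N a))))
  | RStore a b => Some (MState c.+1 N (upd X (N a) (X b)))
  | RAdd d a b => Some (MState c.+1 N (upd X d (X a + X b)))
  | RSub d a b => Some (MState c.+1 N (upd X d (X a - X b)))
  | RJle a b l => Some (MState (if X a <= X b then l else c.+1) N X)
  | Halt => None
  end.

Fixpoint exec (R : realType) (P : seq instr) (k : nat) (st : mstate R)
  : option (mstate R) :=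
  match step P st with
  | None => Some st
  | Some st' => if k is k'.+1 then exec P k' st' else None
  end.

(* Input encoding (adjacency lists, CSR layout):                        *)
(*  N[0] = n, N[1] = s, N[2] = t,                                        *)
(*  N[3 .. 3+n]   = offsets off_0 .. off_n (off_v = sum of degrees < v), *)
(*  N[4+n ..]     = concatenated adjacency lists (length 2m),            *)
(*  X[0 .. 2m-1]  = length of the corresponding adjacency entry,         *)
(*  X[2m + v]     = d_s(v),  X[2m + n + v] = d_t(v);                     *)
(*  all other cells are 0.  Output convention: on halting, N[0] = k and  *)
(*  N[1..k] are the vertices of the output path; k = 0 means "none".     *)
Definition input_state (R : realType) (n : nat) (w : 'I_n -> 'I_n -> R)
  (s t : 'I_n) (ds dt : 'I_n -> R) (adj : 'I_n -> seq 'I_n) : mstate R :=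
  let degs := [seq size (adj v) | v <- enum 'I_n] in
  let offs := [seq sumn (take i degs) | i <- iota 0 n.+1] in
  let nb := flatten [seq map val (adj v) | v <- enum 'I_n] in
  let innat := [:: n; val s; val t] ++ offs ++ nb in
  let inreal := flatten [seq [seq w v u | u <- adj v] | v <- enum 'I_n]
                ++ [seq ds v | v <- enum 'I_n] ++ [seq dt v | v <- enum 'I_n] in
  MState 0 (fun i => nth 0%N innat i) (fun i => nth 0 inreal i).

Definition output_path (R : realType) (st : mstate R) : seq nat :=
  [seq nmem st i.+1 | i <- iota 0 (nmem st 0)].

(* Main.v *)
Require Import Defs.
From HB Require Import structures.
From mathcomp Require Import all_boot all_order all_algebra.
From mathcomp Require Import reals lra zify.
Set Implicit Arguments. Unset Strict Implicit. Unset Printing Implicit Defensive.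
Import Order.TTheory GRing.Theory Num.Theory.
Local Open Scope ring_scope.

(** The value d_s(x) + w(x,y) + d_t(y) belongs to a walk that need not be simple, and shortcutting
    it may lose every arc outside D, as for an arc into a dead end hanging off D. Different labels
    exclude the arcs whose two tree paths enter D at the same vertex; minimality excludes the other
    overlaps. All tests are local. As d_s + d_t is at least d(s,t) everywhere, a vertex is on D when
    d_s + d_t <= d(s,t), and an arc is outside D when it is tight in neither direction. Tightness
    refers to the given distances, so the searches may visit vertices in any order and need no
    priority queue. On the machine, the input starts at address 0 and leaves no cell free for
    registers. It is therefore spread out to high addresses first. There sixteen interleaved arrays
    can grow without a size fixed in advance, and their cells are still 0, so no time goes into
    initialising them. *)

(* Orient shortest-path trees from s and from t, and label every vertex with its
   nearest ancestor lying on D, in each of the two trees.  Every outward path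
   costs at least d_s(x) + w(x,y) + d_t(y) for some arc xy outside D whose
   s-label at x differs from its t-label at y: follow a detour of the path
   between two vertices of D, and look for the place where the labels stop
   agreeing.  Conversely, for an arc minimising this value, the tree path from s
   to x and the tree path from y to t are automatically disjoint, since a common
   vertex would yield, possibly on the detour traversed backwards, a
   cheaper arc; so no shortcutting is needed.  Both labelled trees come from a
   graph search along tight arcs, and the best arc from one scan of the
   adjacency lists.  Every loop has a loop-free body, so its cost is a constant
   times its number of iterations. *)

(** * Distances and shortest-path trees *)

Section PathLength.
Variables (R : realType) (T : finType) (e : rel T) (w : T -> T -> R).
Hypothesis e_sym : symmetric e.
Hypothesis w_sym : forall x y, e x y -> w x y = w y x.
Hypothesis w_gt0 : forall x y, e x y -> 0 < w x y.

Lemma plen1 x : plen w [:: x] = 0.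
Proof. by rewrite /plen /psteps /= big_nil. Qed.

Lemma plen_cons x y p : plen w [:: x, y & p] = w x y + plen w (y :: p).
Proof. by rewrite /plen /psteps /= big_cons. Qed.

Lemma plen_cat x p1 y p2 :
  plen w (x :: p1 ++ y :: p2)
    = plen w (x :: p1) + w (last x p1) y + plen w (y :: p2).
Proof.
elim: p1 x => [|z p1 IH] x /=; first by rewrite plen_cons plen1 add0r.
by rewrite !plen_cons IH !addrA.
Qed.

Lemma plen_ge0 x p : path e x p -> 0 <= plen w (x :: p).
Proof.
elim: p x => [|y p IH] x /=; first by rewrite plen1.
by case/andP=> /w_gt0 wxy /IH; rewrite plen_cons; lra.
Qed.

Lemma plen_rev x p : path e x p -> plen w (rev (x :: p)) = plen w (x :: p).
Proof.
elim: p x => [|y p IH] x //= /andP[exy pth].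
rewrite plen_cons -(IH _ pth) rev_cons -cats1.
case E: (rev (y :: p)) => [|z q]; first by have := size_rev (y :: p); rewrite E.
have -> : (z :: q) ++ [:: x] = z :: q ++ [:: x] by [].
have -> : plen w (z :: q ++ [:: x]) = plen w (z :: q) + w (last z q) x.
  by rewrite plen_cat plen1 addr0.
have -> : last z q = y.
  have := last_rcons z (rev p) y; rewrite -rev_cons E; exact.
by rewrite -(w_sym exy) addrC.
Qed.

Lemma path_rev x p : path e x p -> path e (last x p) (rev (belast x p)).
Proof. by rewrite rev_path; rewrite (eq_path (e' := e)) // => a b; rewrite e_sym. Qed.

Lemma stpathP x y q :
  stpath e x y q <-> exists2 p, q = x :: p & [/\ path e x p, last x p = y & uniq q].
Proof.
split; case: q => [|a q] //=.
- by case/and4P=> /eqP-> pth /eqP l u; exists q.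
- by case.
- by case=> p [-> ->] [pth l u]; rewrite eqxx pth l eqxx u.
Qed.

Lemma stpath_rev x y q : stpath e x y q -> stpath e y x (rev q).
Proof.
case/stpathP=> p -> [pth l u]; apply/stpathP; exists (rev (belast x p)).
  by rewrite lastI rev_rcons l.
split; rewrite ?rev_uniq //; first by rewrite -l path_rev.
case: p {pth u} l => [|z p] l; first by rewrite -l.
by rewrite -l /= rev_cons last_rcons.
Qed.

Lemma is_dist_sym x y r : is_dist e w x y r -> is_dist e w y x r.
Proof.
case=> -[p pp <-] pmin; split.
  exists (rev p); first exact: stpath_rev.
  by case/stpathP: pp => q -> [pth _ _]; apply: plen_rev.
move=> q qq; move: (pmin _ (stpath_rev qq)).
by case/stpathP: qq => q' -> [pth _ _]; rewrite plen_rev.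
Qed.

(** Induction from the far end: if the new first vertex already occurs on the simple path built so
    far, everything before that occurrence is dropped, which cannot lengthen the path because edge
    lengths are positive. *)
Lemma walk_simple x p : path e x p ->
  exists2 q, stpath e x (last x p) q & plen w q <= plen w (x :: p).
Proof.
elim: p x => [|y p IH] x /=; first by exists [:: x]; rewrite //= !eqxx.
case/andP=> exy /IH[q /stpathP[q' ->] [pth l u] le].
have wxy := w_gt0 exy; rewrite plen_cons.
have [|xq] := boolP (x \in y :: q'); last first.
  exists [:: x, y & q']; last by rewrite plen_cons; lra.
  apply/stpathP; exists (y :: q') => //; split=> //; last by rewrite cons_uniq xq.
  by rewrite /= exy.
rewrite inE => /orP[/eqP xy | xq].
  by exists (y :: q'); [apply/stpathP; exists q'; rewrite xy | lra].
case/splitPr: xq u pth l le => p1 p2 u; rewrite cat_path last_cat /=.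
case/and3P=> pth1 exl pth2 l le.
exists (x :: p2).
  apply/stpathP; exists p2 => //; split=> //.
  by move: u; rewrite -cat_cons cat_uniq => /and3P[].
move: le; rewrite plen_cat; have := w_gt0 exl; have := plen_ge0 pth1; lra.
Qed.

Lemma mem_psteps (x : T) p a b : (a, b) \in psteps (x :: p) ->
  exists p1 p2, x :: p = p1 ++ [:: a, b & p2].
Proof.
elim: p x => [|y p IH] x //=; rewrite /psteps /= inE => /orP[/eqP[-> ->]|/IH].
  by exists [::], p.
by case=> p1 [p2 ->]; exists (x :: p1), p2.
Qed.

Lemma psteps_cat (x : T) p y q : (last x p, y) \in psteps (x :: p ++ y :: q).
Proof.
elim: p x => [|z p IH] x; first by rewrite /psteps inE eqxx.
by rewrite /psteps /= inE IH orbT.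
Qed.

Section Distance.
Variables (r : T) (d : T -> R).
Hypothesis d_dist : forall v, is_dist e w r v (d v).

Lemma dist_root : d r = 0.
Proof.
have [[p /stpathP[q -> [pth _ _]] dE] dmin] := d_dist r.
have : stpath e r r [:: r] by rewrite /= !eqxx.
move/dmin; rewrite plen1 -dE => le.
by have := plen_ge0 pth; lra.
Qed.

Lemma dist_walk0 p : path e r p -> d (last r p) <= plen w (r :: p).
Proof.
move=> /walk_simple[q qq le]; have [_ /(_ _ qq)] := d_dist (last r p); lra.
Qed.

Lemma dist_edge x y : e x y -> d y <= d x + w x y.
Proof.
move=> exy; have [[p /stpathP[q -> [pth l _]] <-] _] := d_dist x.
have /dist_walk0 : path e r (q ++ [:: y]) by rewrite cat_path pth l /= exy.
by rewrite last_cat plen_cat plen1 l /=; lra.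
Qed.

(** The triangle inequality read against the direction of the walk. With root [t] it bounds from
    below what the rest of an $st$-path must cost. *)
Lemma dist_walk_rev x p : path e x p -> d x <= d (last x p) + plen w (x :: p).
Proof.
elim: p x => [|y p IH] x /=; first by rewrite plen1; lra.
case/andP=> exy /IH; rewrite plen_cons.
have := @dist_edge y x; rewrite e_sym -(w_sym exy) => /(_ exy); lra.
Qed.

(** The witness comes from the last arc of a shortest path. This is why a search along tight arcs
    misses no vertex. *)
Lemma dist_tight_pred v : v != r -> exists2 u, e u v & d u + w u v <= d v.
Proof.
move=> vr; have [[p /stpathP[q -> []]]] := d_dist v.
case/lastP: q => [|q z]; first by move=> _ /= rv; rewrite rv eqxx in vr.
rewrite rcons_path last_rcons => /andP[pth ez] zv _; subst z => <- _.
exists (last r q) => //.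
by rewrite -cats1 plen_cat plen1; have := dist_walk0 pth; lra.
Qed.

Lemma dist_mem_shortest v p u :
  stpath e r v p -> plen w p = d v -> u \in p -> d u <= d v.
Proof.
case/stpathP=> q -> [pth l _] dv; rewrite inE => /orP[/eqP->|uq].
  by rewrite dist_root -dv; apply: plen_ge0.
case/splitPr: uq pth l dv => q1 q2; rewrite -cat_rcons cat_path last_rcons.
case/andP=> /dist_walk0; rewrite last_rcons -cats1 plen_cat plen1 => le pth2 _.
by rewrite -catA plen_cat; have := plen_ge0 pth2; lra.
Qed.

End Distance.
End PathLength.

(** * Trees of tight arcs with labels and depths *)

Section ShortestPathTree.
Variables (R : realType) (T : finType) (e : rel T) (w : T -> T -> R).
Variables (inV : pred T) (r : T) (d : T -> R).

(** [dep] counts the vertices up to the root, root included: it makes parent induction well founded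
    and leaves 0 free to mean unvisited in the program. Tightness is the inequality that the program
    tests; [dist_edge] supplies the converse. The parent of the root is left open. *)
Record tight_tree (par lab : T -> T) (dep : T -> nat) : Prop := TightTree {
  dep_gt0 : forall v, (0 < dep v)%N;
  dep_root : dep r = 1%N;
  dep_par : forall v, v != r -> dep v = (dep (par v)).+1;
  par_edge : forall v, v != r -> e (par v) v;
  par_tight : forall v, v != r -> d (par v) + w (par v) v <= d v;
  lab_in : forall v, inV v -> lab v = v;
  lab_out : forall v, ~~ inV v -> lab v = lab (par v) }.

Hypothesis e_sym : symmetric e.
Hypothesis w_sym : forall x y, e x y -> w x y = w y x.
Hypothesis w_gt0 : forall x y, e x y -> 0 < w x y.
Hypothesis d_dist : forall v, is_dist e w r v (d v).
Hypothesis inV_root : inV r.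

Variables (par lab : T -> T) (dep : T -> nat).
Hypothesis tree : tight_tree par lab dep.

Lemma par_tightE v : v != r -> d v = d (par v) + w (par v) v.
Proof.
move=> vr; have := par_tight tree vr.
by have := dist_edge w_gt0 d_dist (par_edge tree vr); lra.
Qed.

Lemma dep_ind (Q : T -> Prop) :
  Q r -> (forall v, v != r -> Q (par v) -> Q v) -> forall v, Q v.
Proof.
move=> Qr Qp v; elim: {v}(dep v) {-2}v (leqnn (dep v)) => [|k IH] v.
  by rewrite leqNgt (dep_gt0 tree).
have [->//|vr] := eqVneq v r.
by rewrite (dep_par tree vr) ltnS => /IH; apply: Qp.
Qed.

Definition chain v := traject par v (dep v).

Lemma chain_root : chain r = [:: r].
Proof. by rewrite /chain (dep_root tree). Qed.

Lemma chainE v : v != r -> chain v = v :: chain (par v).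
Proof. by move=> vr; rewrite /chain (dep_par tree vr). Qed.

Lemma chain_spec v : exists p,
  [/\ chain v = v :: p, path e v p, last v p = r & plen w (v :: p) = d v].
Proof.
move: v; apply: dep_ind => [|v vr [p [cE pth l len]]].
  by exists [::]; rewrite chain_root plen1 (dist_root w_gt0 d_dist).
have ev := par_edge tree vr.
exists (par v :: p); rewrite chainE // cE /= e_sym ev pth l; split=> //.
by rewrite plen_cons len (par_tightE vr) (w_sym ev) addrC.
Qed.

(** Each step to a parent lowers the distance by a positive edge length; hence no vertex can repeat
    on a chain. *)
Lemma chain_le v u : u \in chain v -> u = v \/ d u < d v.
Proof.
move: v; apply: dep_ind => [|v vr IH].
  by rewrite chain_root inE => /eqP->; left.
rewrite chainE // inE => /orP[/eqP->|/IH dlt]; [by left | right].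
rewrite (par_tightE vr); have := w_gt0 (par_edge tree vr).
by case: dlt => [->|]; lra.
Qed.

Lemma chain_uniq v : uniq (chain v).
Proof.
move: v; apply: dep_ind => [|v vr IH]; first by rewrite chain_root.
rewrite chainE //= IH andbT; apply/negP=> /chain_le.
have := par_tightE vr; have := w_gt0 (par_edge tree vr).
by move=> ? ? []; [move/(congr1 d) |]; lra.
Qed.

Lemma dep_card v : (dep v <= #|T|)%N.
Proof.
by have /card_uniqP := chain_uniq v; rewrite size_traject => <-; apply: max_card.
Qed.

Hypothesis inV_par : forall v, v != r -> inV v -> inV (par v).

Lemma lab_inV v : inV (lab v).
Proof.
move: v; apply: dep_ind => [|v vr IH]; first by rewrite (lab_in tree).
by have [i|i] := boolP (inV v); [rewrite (lab_in tree) | rewrite (lab_out tree)].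
Qed.

Lemma chain_inV v u : inV v -> u \in chain v -> inV u.
Proof.
move: v; apply: dep_ind => [|v vr IH] iv; first by rewrite chain_root inE => /eqP->.
rewrite chainE // inE => /orP[/eqP->//|]; exact/IH/inV_par.
Qed.

(** A chain splits at [lab v]: before it all vertices lie outside [inV] and share that label, and
    from it on all lie in [inV], which is closed under parents. *)
Lemma chain_lab v u : u \in chain v ->
  if inV u then u = lab v \/ d u < d (lab v) else lab u = lab v.
Proof.
move: v; apply: dep_ind => [|v vr IH] uc.
  move: uc; rewrite chain_root inE => /eqP->.
  by rewrite inV_root; left; rewrite (lab_in tree).
have [iv|iv] := boolP (inV v).
  by rewrite (chain_inV iv uc) (lab_in tree iv); apply: chain_le.
move: uc; rewrite chainE // inE (lab_out tree iv) => /orP[/eqP->|/IH//].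
by rewrite (negbTE iv) (lab_out tree iv).
Qed.

(** The piece of the chain from [v] up to its label. Every arc on it leaves a vertex outside [inV],
    so any relation [f] valid for such arcs holds along the piece; it will be taken to be adjacency
    outside D. *)
Lemma lab_walk (f : simpl_rel T) v :
  (forall u, u != r -> ~~ inV u -> f u (par u)) -> exists p,
  [/\ path f v p, path e v p, last v p = lab v
    & plen w (v :: p) = d v - d (lab v)].
Proof.
move=> fpar; move: v; apply: dep_ind => [|v vr [p [fp pth l len]]].
  by exists [::]; rewrite plen1 (lab_in tree) //= subrr.
have [iv|iv] := boolP (inV v).
  by exists [::]; rewrite plen1 (lab_in tree) //= subrr.
have ev := par_edge tree vr.
exists (par v :: p); rewrite /= fpar // fp e_sym ev pth l (lab_out tree iv).
split=> //; rewrite plen_cons len (par_tightE vr) (w_sym ev); lra.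
Qed.

End ShortestPathTree.

(** * Arcs outside D and the candidates for an optimal detour *)

Section Outward.
Variables (R : realType) (T : finType) (e : rel T) (w : T -> T -> R).
Variables (s t : T) (ds dt : T -> R).

(** Membership in D expressed by the given distances only, so that the program can decide it in
    constant time. [inDP] ties the arc test to the union of all shortest paths. *)
Definition onD v := ds v + dt v <= ds t.
Definition offD x y := (ds t < ds x + w x y + dt y) && (ds t < ds y + w x y + dt x).

Hypothesis e_sym : symmetric e.
Hypothesis w_sym : forall x y, e x y -> w x y = w y x.
Hypothesis w_gt0 : forall x y, e x y -> 0 < w x y.
Hypothesis ds_dist : forall v, is_dist e w s v (ds v).
Hypothesis dt_dist : forall v, is_dist e w t v (dt v).

Let ds_edge := dist_edge w_gt0 ds_dist.
Let dt_edge := dist_edge w_gt0 dt_dist.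

Lemma dst_le v : ds t <= ds v + dt v.
Proof.
have [[p /stpathP[q -> [pth l _]] <-] _] := dt_dist v.
have := dist_walk_rev e_sym w_sym w_gt0 ds_dist pth; rewrite l; lra.
Qed.

Lemma dt_s : dt s = ds t.
Proof.
have := dst_le s; have := dist_root w_gt0 ds_dist.
have [[p /stpathP[q -> [pth l _]] <-] _] := ds_dist t.
have := dist_walk_rev e_sym w_sym w_gt0 dt_dist pth; rewrite l.
have := dist_root w_gt0 dt_dist; lra.
Qed.

Lemma onD_s : onD s.
Proof. rewrite /onD dt_s (dist_root w_gt0 ds_dist); lra. Qed.

Lemma onD_t : onD t.
Proof. rewrite /onD (dist_root w_gt0 dt_dist); lra. Qed.

Lemma offD_sym x y : e x y -> offD x y = offD y x.
Proof. by move=> exy; rewrite /offD (w_sym exy) andbC. Qed.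

Lemma onD_edge x y : e x y -> ~~ offD x y -> onD x && onD y.
Proof.
move=> exy; have eyx : e y x by rewrite e_sym.
have := ds_edge exy; have := dt_edge exy; have := ds_edge eyx; have := dt_edge eyx.
rewrite -(w_sym exy) negb_and -!leNgt /onD => ? ? ? ? /orP[?|?]; apply/andP; lra.
Qed.

Lemma offD_outl x y : e x y -> ~~ onD x -> offD x y.
Proof. by move=> exy; apply: contraR => /(onD_edge exy) /andP[]. Qed.

(** Cut a shortest path at the arc: the prefix costs at least [ds] of the tail and the suffix at
    least [dt] of the head, so the arc is tight in the direction of travel. *)
Lemma inD_step x y : inD e w s t x y -> e x y -> ~~ offD x y.
Proof.
case=> p [[/stpathP[q -> [pth l _]] pmin] xyp] exy.
have {}pmin : plen w (s :: q) <= ds t.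
  by have [[q' /pmin le <-] _] := ds_dist t.
suff step a b : e a b -> (a, b) \in psteps (s :: q) -> ds a + w a b + dt b <= ds t.
  rewrite negb_and -!leNgt; case/orP: xyp => /step; first by move=> ->.
  by rewrite e_sym (w_sym exy) => -> //; rewrite orbT.
move=> eab; case/mem_psteps=> -[|z p1] [p2] /= [z_s qE].
  move: pth l pmin; rewrite qE -z_s plen_cons (dist_root w_gt0 ds_dist).
  move=> /= /andP[_ pth] l.
  have := dist_walk_rev e_sym w_sym w_gt0 dt_dist pth; rewrite l (dist_root w_gt0 dt_dist); lra.
move: pth l pmin; rewrite qE plen_cat plen_cons cat_path last_cat /=.
case/and4P=> pth1 elz _ pth2 l.
have : path e s (rcons p1 a) by rewrite rcons_path pth1.
move/(dist_walk0 w_gt0 ds_dist); rewrite last_rcons -cats1 plen_cat plen1.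
have := dist_walk_rev e_sym w_sym w_gt0 dt_dist pth2; rewrite l (dist_root w_gt0 dt_dist); lra.
Qed.

(** Glue a shortest path to [x], the arc, and a shortest path from [y]. The result is simple, since
    a common vertex [u] would have [ds u + dt u <= ds x + dt y < ds t], against [dst_le]. *)
Lemma tight_inD x y : e x y -> ds x + w x y + dt y <= ds t ->
  exists2 p, shortest e w s t p & (x, y) \in psteps p.
Proof.
move=> exy le.
have [[p1 st1 len1] _] := ds_dist x; have [[p2 st2 len2] _] := dt_dist y.
have mem1 := dist_mem_shortest w_gt0 ds_dist st1 len1.
have mem2 := dist_mem_shortest w_gt0 dt_dist st2 len2.
case/stpathP: (st2) => q2 E2 [pth2 _ _].
have := plen_rev w_sym pth2; rewrite -E2 len2 => {}len2.
case/stpathP: (stpath_rev e_sym st2) => q3 E3 [pth3 l3 u3].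
case/stpathP: st1 => q1 E1 [pth1 l1 u1].
have disj u : u \in p1 -> u \in rev p2 -> False.
  rewrite mem_rev => /mem1 u1' /mem2 u2; have := dst_le u; have := w_gt0 exy; lra.
rewrite E3 in len2 u3 disj; rewrite E1 in len1 u1 disj.
have lenP : plen w (s :: q1 ++ y :: q3) <= ds t by rewrite plen_cat len1 len2 l1.
exists (s :: q1 ++ y :: q3); last by rewrite -{1}l1 psteps_cat.
split; last by move=> q /(proj2 (ds_dist t)); lra.
apply/stpathP; exists (q1 ++ y :: q3) => //; split.
- by rewrite cat_path pth1 l1 /= exy.
- by rewrite last_cat.
rewrite -cat_cons cat_uniq u1 u3 andbT andTb.
by apply/hasPn => u u3'; apply/negP => /disj /(_ u3').
Qed.

Lemma inDP x y : e x y -> inD e w s t x y <-> ~~ offD x y.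
Proof.
move=> exy; split; first by move/inD_step; apply.
rewrite negb_and -!leNgt => /orP[/(tight_inD exy)[p ps xyp]|le].
  by exists p; rewrite /pedge xyp.
have [||p ps yxp] := @tight_inD y x; first by rewrite e_sym.
  by rewrite -w_sym.
by exists p; rewrite /pedge yxp orbT.
Qed.

Lemma outward_has_offD q : outward e w s t q ->
  exists2 p, q = s :: p &
  [/\ path e s p, last s p = t, uniq q & exists2 ab, ab \in psteps q & offD ab.1 ab.2].
Proof.
case=> /stpathP[p -> [pth l u]] [x [y [exy [xyp nD]]]].
exists p => //; split=> //.
have off : offD x y by apply/negPn/negP => /(inDP exy).
case/orP: xyp => ?; first by exists (x, y).
by exists (y, x); rewrite //= -(offD_sym exy).
Qed.

Let erel := [rel x y | e x y && offD x y].

(** Follow the path to its first return to D. Until then each further arc starts at a vertex outside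
    D, and by [offD_outl] such an arc is outside D. *)
Lemma offD_run x y p : path e x (y :: p) -> onD (last y p) -> offD x y ->
  exists p1 p2, [/\ p = p1 ++ p2, path erel x (y :: p1) & onD (last y p1)].
Proof.
elim: p x y => [|z p IH] x y /=; first by rewrite andbT => -> ? ->; exists [::], [::].
case/and3P=> exy eyz pth l off.
have [oy|oy] := boolP (onD y); first by exists [::], (z :: p); rewrite /= exy off.
have [|||p1 [p2 [-> pth1 l1]]] := IH y z; first by rewrite /= eyz.
  exact: l.
  exact: offD_outl.
exists (z :: p1), p2; split=> //; move: pth1 => /= ->; by rewrite exy off.
Qed.

Variables (ps ls pt lt : T -> T) (dps dpt : T -> nat).
Hypothesis tree_s : tight_tree e w onD s ds ps ls dps.
Hypothesis tree_t : tight_tree e w onD t dt pt lt dpt.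

(** If [ls x = lt y], both tree paths contain this common vertex, so joining them through the arc
    would not give a simple path. *)
Definition candidate x y := [&& e x y, offD x y & ls x != lt y].
Definition cand_val x y := ds x + w x y + dt y.

(* A walk between differently labelled vertices that avoids D contains an arc
   (or a vertex, whose arc to its t-parent then qualifies) where the s-label
   and the t-label disagree. *)
Lemma walk_candidate0 x : ls x != lt x ->
  exists a b, candidate a b /\ cand_val a b <= ds x + dt x.
Proof.
move=> lx.
have nx : ~~ onD x.
  by apply: contraNN lx => ox; rewrite (lab_in tree_s ox) (lab_in tree_t ox).
have xt : x != t by apply: contraNneq nx => ->; apply: onD_t.
have ex : e x (pt x) by rewrite e_sym (par_edge tree_t xt).
exists x, (pt x); split; first by rewrite /candidate ex offD_outl // -(lab_out tree_t nx).
by rewrite /cand_val (w_sym ex); have := par_tight tree_t xt; lra.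
Qed.

Lemma walk_candidate x p : path erel x p -> ls x != lt (last x p) ->
  exists a b, candidate a b /\ cand_val a b <= ds x + plen w (x :: p) + dt (last x p).
Proof.
elim: p x => [|y p IH] x /=.
  by move=> _ /walk_candidate0[a [b [ab le]]]; exists a, b; rewrite plen1; split=> //; lra.
case/andP=> /andP[exy off] pth lx; rewrite plen_cons.
have pe : path e y p by apply: sub_path pth => a b /andP[].
have := ds_edge exy; have := dist_walk_rev e_sym w_sym w_gt0 dt_dist pe.
have [lxy dty dsy|lxy dty dsy] := eqVneq (ls x) (lt y); last first.
  by exists x, y; rewrite /candidate exy off lxy; split=> //; rewrite /cand_val; lra.
(* Here [lt y = ls x] differs from the final t-label. If [ls y] equals that final label, the two
   labels of [y] disagree; otherwise the rest of the walk still has disagreeing ends. *)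
have [lyl|lyl] := eqVneq (ls y) (lt (last y p)).
  have /walk_candidate0[a [b [ab le]]] : ls y != lt y by rewrite lyl -lxy eq_sym.
  by exists a, b; split=> //; lra.
by have [a [b [ab le]]] := IH _ pth lyl; exists a, b; split=> //; lra.
Qed.

(** Move along the path inside D up to its first arc outside D, then follow the detour to its
    return. Simplicity makes the two ends distinct, and vertices of D are their own labels, so
    [walk_candidate] applies. *)
Lemma onD_walk_candidate x p : path e x p -> last x p = t -> uniq (x :: p) -> onD x ->
  (exists2 ab, ab \in psteps (x :: p) & offD ab.1 ab.2) ->
  exists a b, candidate a b /\ cand_val a b <= ds x + plen w (x :: p).
Proof.
elim: p x => [|y p IH] x pth l u ox [[a b]] //.
have [pth' exy] : path e y p /\ e x y by move: pth => /= /andP[].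
rewrite plen_cons => ab off.
have [oxy|oxy] := boolP (offD x y).
  have [|p1 [p2 [pE pth1 l1]]] := offD_run pth _ oxy; first by rewrite [last _ _]l onD_t.
  have [|a' [b' [c le]]] := walk_candidate pth1.
    rewrite (lab_in tree_s ox) (lab_in tree_t l1).
    move: u => /= /andP[xn _]; apply: contraNneq xn => ->.
    by rewrite pE -cat_cons mem_cat mem_last.
  exists a', b'; split=> //.
  move: le pth' l; rewrite pE /= plen_cons cat_path => le /andP[_ pth2].
  rewrite last_cat => l2; have := dist_walk_rev e_sym w_sym w_gt0 dt_dist pth2.
  rewrite l2 (dist_root w_gt0 dt_dist).
  case: p2 {pE l2 pth2} => [|z p2]; first by rewrite plen1 cats0; lra.
  by rewrite plen_cat plen_cons; lra.
have /andP[_ oy] := onD_edge exy oxy.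
have [|||||a' [b' [c le]]] := IH y => //; first by case/andP: u.
  exists (a, b) => //; move: ab; rewrite inE => /orP[/eqP[? ?]|//].
  by subst; rewrite off in oxy.
by exists a', b'; split=> //; have := ds_edge exy; lra.
Qed.

Lemma outward_candidate q : outward e w s t q ->
  exists a b, candidate a b /\ cand_val a b <= plen w q.
Proof.
case/outward_has_offD=> p -> [pth l u off].
have [a [b [ab le]]] := onD_walk_candidate pth l u onD_s off.
by exists a, b; split=> //; rewrite (dist_root w_gt0 ds_dist) in le; lra.
Qed.

(** Going to the parent lowers [ds] by the arc length, while [dt] grows by at most that length. *)
Lemma onD_par_s v : v != s -> onD v -> onD (ps v).
Proof.
move=> vs ov; have ev := par_edge tree_s vs.
rewrite /onD in ov *; have := par_tight tree_s vs.
have := dt_edge (x := v) (y := ps v); rewrite e_sym -(w_sym ev) => /(_ ev); lra.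
Qed.

Lemma onD_par_t v : v != t -> onD v -> onD (pt v).
Proof.
move=> vs ov; have ev := par_edge tree_t vs.
rewrite /onD in ov *; have := par_tight tree_t vs.
have := ds_edge (x := v) (y := pt v); rewrite e_sym -(w_sym ev) => /(_ ev); lra.
Qed.

Let lsD := lab_inV onD_s tree_s.
Let ltD := lab_inV onD_t tree_t.

(* If the t-label of y precedes the s-label of x, traversing the detour
   backwards yields a strictly better candidate. *)
Lemma best_candidate_labels x y : candidate x y ->
  (forall a b, candidate a b -> cand_val x y <= cand_val a b) -> ds (ls x) <= ds (lt y).
Proof.
case/and3P=> exy off lxy best; rewrite leNgt; apply/negP=> lt_ba.
have fs v : v != s -> ~~ onD v -> erel v (ps v).
  by move=> vs ov; rewrite /= e_sym (par_edge tree_s vs) offD_outl // e_sym (par_edge tree_s vs).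
have ft v : v != t -> ~~ onD v -> erel v (pt v).
  by move=> vs ov; rewrite /= e_sym (par_edge tree_t vs) offD_outl // e_sym (par_edge tree_t vs).
have [p [fp pth lp lenp]] := lab_walk e_sym w_sym w_gt0 ds_dist onD_s tree_s x fs.
have [q [_ pthq lq lenq]] := lab_walk e_sym w_sym w_gt0 dt_dist onD_t tree_t y ft.
have := dist_walk_rev e_sym w_sym w_gt0 ds_dist pthq; rewrite lenq lq => dsy.
have := dist_walk_rev e_sym w_sym w_gt0 dt_dist pth; rewrite lenp lp => dtx.
have := lsD x; have := ltD y; have := dst_le (ls x); have := dst_le (lt y).
rewrite /onD => ? ? ? ?.
have eyx : e y x by rewrite e_sym.
have wyx := w_sym exy.
(* The bound is the cost of the detour run backwards, from [lt y] to [ls x] and on to [t]. As both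
   labels are on D, it differs from [cand_val x y] by [2 * (ds (lt y) - ds (ls x))], which is
   negative. *)
suff [a [b [/best]]] : exists a b, candidate a b /\
    cand_val a b <= ds (lt y) + (dt y - dt (lt y)) + w x y + (ds x - ds (ls x)) + dt (ls x).
  by rewrite /cand_val; lra.
(* Either the labels of [y] itself disagree, or the walk from [y] over [x] to [ls x] has disagreeing
   ends, its last vertex being its own t-label. *)
have [ly|ly] := eqVneq (ls y) (ls x).
  have /walk_candidate0[a [b [ab le]]] : ls y != lt y by rewrite ly.
  by exists a, b; split=> //; have := dt_edge eyx; have := dt_edge exy; lra.
have [||a [b [ab le]]] := @walk_candidate y (x :: p).
- by rewrite /= eyx -(offD_sym exy) off.
- by rewrite /= lp (lab_in tree_t (lsD x)).
by exists a, b; split=> //; move: le; rewrite /= plen_cons lenp lp; lra.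
Qed.

Definition best_path x y := rev (chain ps dps x) ++ chain pt dpt y.

Lemma best_path_opt x y : candidate x y ->
  (forall a b, candidate a b -> cand_val x y <= cand_val a b) ->
  opt_outward e w s t (best_path x y).
Proof.
move=> xy best; have le_lab := best_candidate_labels xy best.
case/and3P: (xy) => exy off lxy.
have [p [pE pth lp lenp]] := chain_spec e_sym w_sym w_gt0 ds_dist tree_s x.
have [q [qE pthq lq lenq]] := chain_spec e_sym w_sym w_gt0 dt_dist tree_t y.
(* A common vertex on D is no farther from [s] than [ls x] and no nearer than [lt y], so [le_lab]
   forces all three to coincide, contradicting [lxy]. A common vertex outside D has disagreeing
   labels, hence yields a candidate of value at most [ds x + dt y], below the minimum. *)
have disj u : u \in chain ps dps x -> u \in chain pt dpt y -> False.
  move=> ux uy; clear pE qE lp lq.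
  have := chain_lab w_gt0 ds_dist onD_s tree_s onD_par_s ux.
  have := chain_lab w_gt0 dt_dist onD_t tree_t onD_par_t uy.
  have [ou|ou] := boolP (onD u).
    have := lsD x; have := ltD y; have := dst_le (ls x); have := dst_le (lt y).
    have := dst_le u; rewrite /onD in ou * => ? ? ? ? ? [ut|ut] [us|us].
    - by rewrite -us -ut eqxx in lxy.
    - by rewrite -ut in le_lab; lra.
    - by rewrite -us in le_lab; lra.
    - lra.
  move=> lt_u ls_u; have /walk_candidate0[a [b [/best]]] : ls u != lt u.
    by rewrite lt_u ls_u.
  rewrite /cand_val; have := w_gt0 exy.
  have : ds u <= ds x by have [->|/ltW] := chain_le w_gt0 ds_dist tree_s ux.
  have : dt u <= dt y by have [->|/ltW] := chain_le w_gt0 dt_dist tree_t uy.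
  by lra.
have ux := chain_uniq w_gt0 ds_dist tree_s x; have uy := chain_uniq w_gt0 dt_dist tree_t y.
have := plen_rev w_sym pth; have := path_rev e_sym pth.
have revE : rev (x :: p) = s :: rev (belast x p) by rewrite lastI rev_rcons lp.
rewrite lp revE => pthr lenr.
have lr : last s (rev (belast x p)) = x.
  by case: (p) lp => [/=->//|z p' _]; rewrite /= rev_cons last_rcons.
have bpE : best_path x y = s :: rev (belast x p) ++ y :: q.
  by rewrite /best_path pE qE revE.
have len : plen w (best_path x y) = cand_val x y.
  by rewrite bpE plen_cat lenr lr lenp lenq.
split; last first.
  by move=> q' /outward_candidate[a [b [/best le1 le2]]]; rewrite len (le_trans le1).
split; last first.
  exists x, y; split=> //; split.
    by rewrite /pedge bpE -{1}lr psteps_cat.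
  by move/(inDP exy); rewrite off.
apply/stpathP; exists (rev (belast x p) ++ y :: q) => //; split.
- by rewrite cat_path pthr lr /= exy.
- by rewrite last_cat.
rewrite /best_path cat_uniq rev_uniq ux uy andbT andTb.
by apply/hasPn => u u2; apply/negP; rewrite mem_rev => /disj; apply.
Qed.

End Outward.

(** * Composable runs of the machine and straight-line code *)

Section Machine.
Variable R : realType.
Local Open Scope nat_scope.

Definition memory := ((nat -> nat) * (nat -> R))%type.
Definition at_ (l : nat) (m : memory) : mstate R := MState l m.1 m.2.

(** Unlike [exec], which yields a state only at a halt, this describes partial runs with an exact
    step count, so that runs compose. *)
Fixpoint runs (P : seq instr) k (st st' : mstate R) : Prop :=
  if k is k'.+1 then exists2 st1, step P st = Some st1 & runs P k' st1 st'
  else st = st'.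

Lemma runs_trans P k1 k2 st1 st2 st3 :
  runs P k1 st1 st2 -> runs P k2 st2 st3 -> runs P (k1 + k2) st1 st3.
Proof.
elim: k1 st1 => [|k1 IH] st1 /=; first by move=> ->.
by case=> st' E r1 r2; exists st' => //; apply: IH.
Qed.

Lemma runs_exec P k K st st' : runs P k st st' -> nth Halt P (pc st') = Halt ->
  k <= K -> exec P K st = Some st'.
Proof.
elim: k K st => [|k IH] K st /=.
  by move=> -> h _; case: K => [|K] /=; case: st' h => c N X /= ->.
by case=> st1 E r h; case: K => // K leK /=; rewrite E; apply: IH.
Qed.

Definition code_at (P : seq instr) l C :=
  forall i, i < size C -> nth Halt P (l + i) = nth Halt C i.

Lemma code_at_cat P l C1 C2 : code_at P l (C1 ++ C2) ->
  code_at P l C1 /\ code_at P (l + size C1) C2.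
Proof.
move=> h; split=> i lti.
  by rewrite h ?size_cat ?ltn_addr // nth_cat lti.
by rewrite -addnA h ?size_cat ?ltn_add2l // nth_cat ltnNge leq_addr addKn.
Qed.

Lemma code_at_cons P l i C : code_at P l (i :: C) ->
  nth Halt P l = i /\ code_at P l.+1 C.
Proof.
by move=> /(@code_at_cat P l [:: i]) [/(_ 0 isT) /=]; rewrite addn0 addn1.
Qed.

Definition straight i := match i with NJle _ _ _ | RJle _ _ _ | Halt => false | _ => true end.

Definition isem (m : memory) i : memory :=
  let N := m.1 in let X := m.2 in
  match i with
  | NConst d k => (upd N d k, X)
  | NAdd d a b => (upd N d (N a + N b), X)
  | NSub d a b => (upd N d (N a - N b), X)
  | NLoad d a => (upd N d (N (N a)), X)
  | NStore a b => (upd N (N a) (N b), X)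
  | RLoad d a => (N, upd X d (X (N a)))
  | RStore a b => (N, upd X (N a) (X b))
  | RAdd d a b => (N, upd X d (X a + X b)%R)
  | RSub d a b => (N, upd X d (X a - X b)%R)
  | _ => m
  end.

Notation run := (foldl isem).

Lemma runs_straight P l C m : all straight C -> code_at P l C ->
  runs P (size C) (at_ l m) (at_ (l + size C) (run m C)).
Proof.
elim: C l m => [|i C IH] l m /=; first by rewrite addn0.
case/andP=> si sC /code_at_cons[E h].
exists (at_ l.+1 (isem m i)).
  by rewrite /at_ /= E; case: i si {E}.
by rewrite addnS -addSn; apply: IH.
Qed.

Lemma runs_jump P l m l' : nth Halt P l = NJle 0 0 l' -> runs P 1 (at_ l m) (at_ l' m).
Proof. by move=> E /=; exists (at_ l' m) => //; rewrite /at_ /= E leqnn. Qed.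

Lemma runs_njle P l (m : memory) a b l' : nth Halt P l = NJle a b l' ->
  runs P 1 (at_ l m) (at_ (if m.1 a <= m.1 b then l' else l.+1) m).
Proof. by move=> E /=; eexists; last reflexivity; rewrite /at_ /= E. Qed.

Lemma runs_rjle P l (m : memory) a b l' : nth Halt P l = RJle a b l' ->
  runs P 1 (at_ l m) (at_ (if (m.2 a <= m.2 b)%R then l' else l.+1) m).
Proof. by move=> E /=; eexists; last reflexivity; rewrite /at_ /= E. Qed.

End Machine.
Notation run := (foldl (@isem _)).

(** * A small imperative language with variables and unbounded arrays *)

Record store (R : realType) := Store {
  nvar : nat -> nat; rvar : nat -> R; narr : nat -> nat -> nat; rarr : nat -> R }.

Inductive nexp :=
| EConst of nat | EVar of nat | EAdd of nexp & nexp | ESub of nexp & nexp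
| EIdx of nat & nexp.

Inductive rexp := RVar of nat | RIdx of nexp | RSum of rexp & rexp.

Inductive cmd :=
| Skip
| NAssign of nat & nexp
| NWrite of nat & nexp & nexp
| RAssign of nat & rexp
| IfN of nexp & nexp & cmd & cmd
| IfR of rexp & rexp & cmd & cmd
| Seq of cmd & cmd.

Inductive stage := Block of cmd | Loop of nexp & nexp & cmd.

Section Language.
Variable R : realType.
Local Open Scope nat_scope.
Implicit Type s : store R.

Fixpoint neval s a := match a with
  | EConst k => k
  | EVar v => nvar s v
  | EAdd a b => neval s a + neval s b
  | ESub a b => neval s a - neval s b
  | EIdx k a => narr s k (neval s a)
  end.

Fixpoint reval s r : R := match r with
  | RVar v => rvar s v
  | RIdx a => rarr s (neval s a)
  | RSum a b => (reval s a + reval s b)%R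
  end.

Fixpoint crun s c := match c with
  | Skip => s
  | NAssign v a => Store (upd (nvar s) v (neval s a)) (rvar s) (narr s) (rarr s)
  | NWrite k i a =>
      Store (nvar s) (rvar s)
        (upd (narr s) k (upd (narr s k) (neval s i) (neval s a))) (rarr s)
  | RAssign v r => Store (nvar s) (upd (rvar s) v (reval s r)) (narr s) (rarr s)
  | IfN a b c1 c2 => if neval s a <= neval s b then crun s c1 else crun s c2
  | IfR a b c1 c2 => if (reval s a <= reval s b)%R then crun s c1 else crun s c2
  | Seq c1 c2 => crun (crun s c1) c2
  end.

(* Cell 0 holds the base address A, cells 1..31 the variables, cells 32..127
   are scratch, and entry i of array k < 16 lives at A + 16 i + k. *)
Definition sim A s (m : memory R) :=
  [/\ 128 <= A, m.1 0 = A, forall v, 0 < v < 32 -> m.1 v = nvar s v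
    & [/\ forall v, v < 32 -> m.2 v = rvar s v,
          forall k i, k < 16 -> m.1 (A + (16 * i + k)) = narr s k i
        & forall i, m.2 (A + 16 * i) = rarr s i]].

(** Evaluation at level [d] may disturb only the scratch cells from [d] to 127; the cells below [d]
    hold variables and pending operands. *)
Definition nframe d (m m' : memory R) := forall i, (i < d) || (128 <= i) -> m'.1 i = m.1 i.
Definition rframe d (m m' : memory R) := forall i, (i < d) || (128 <= i) -> m'.2 i = m.2 i.

Lemma sim_frame A s m m' : sim A s m -> nframe 32 m m' -> rframe 32 m m' -> sim A s m'.
Proof.
move=> [hA h0 hn [hr ha hx]] fn fr; split=> //; first by rewrite fn.
  by move=> v /andP[v0 v1]; rewrite fn ?v1 // hn // v0.
split=> [v v1|k i k1|i]; first by rewrite fr ?v1 // hr.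
  by rewrite fn ?ha //; lia.
by rewrite fr ?hx //; lia.
Qed.

(** Without multiplication, the factor 16 is obtained by four doublings; this is why the array
    stride is a power of two. *)
Definition addr_code d k : seq instr :=
  [:: NAdd d d d; NAdd d d d; NAdd d d d; NAdd d d d; NAdd d d 0; NConst d.+1 k; NAdd d d d.+1].

Fixpoint ncode d a : seq instr := match a with
  | EConst k => [:: NConst d k]
  | EVar v => [:: NConst d 0; NAdd d d v]
  | EAdd a b => ncode d a ++ ncode d.+1 b ++ [:: NAdd d d d.+1]
  | ESub a b => ncode d a ++ ncode d.+1 b ++ [:: NSub d d d.+1]
  | EIdx k a => ncode d a ++ addr_code d k ++ [:: NLoad d d]
  end.

Fixpoint rcode d r : seq instr := match r with
  | RVar v => [:: NConst d v; RLoad d d]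
  | RIdx a => ncode d a ++ addr_code d 0 ++ [:: RLoad d d]
  | RSum a b => rcode d a ++ rcode d.+1 b ++ [:: RAdd d d d.+1]
  end.

(** Number of scratch cells needed. A right operand is evaluated one cell higher, with the left
    value waiting below; an address computation takes a second cell for the array number. *)
Fixpoint nheight a := match a with
  | EConst _ | EVar _ => 1
  | EAdd a b | ESub a b => maxn (nheight a) (nheight b).+1
  | EIdx _ a => maxn (nheight a) 2
  end.

Fixpoint rheight r := match r with
  | RVar _ => 1
  | RIdx a => maxn (nheight a) 2
  | RSum a b => maxn (rheight a) (rheight b).+1
  end.

Fixpoint nwf a := match a with
  | EConst _ => true
  | EVar v => 0 < v < 32
  | EAdd a b | ESub a b => nwf a && nwf b
  | EIdx k a => (k < 16) && nwf a
  end.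

Fixpoint rwf r := match r with
  | RVar v => v < 32
  | RIdx a => nwf a
  | RSum a b => rwf a && rwf b
  end.

Lemma ncode_straight d a : all straight (ncode d a).
Proof. by elim: a d => //= [a Ha b Hb|a Ha b Hb|k a Ha] d; rewrite !all_cat ?Ha ?Hb. Qed.

Lemma rcode_straight d r : all straight (rcode d r).
Proof.
by elim: r d => //= [a|a Ha b Hb] d; rewrite !all_cat ?ncode_straight ?Ha ?Hb.
Qed.

Lemma updE (V : Type) (f : nat -> V) a v i : upd f a v i = if i == a then v else f i.
Proof. by []. Qed.

Lemma upd_eq (V : Type) (f : nat -> V) a v : upd f a v a = v.
Proof. by rewrite /upd eqxx. Qed.

Lemma upd_neq (V : Type) (f : nat -> V) a v i : i != a -> upd f a v i = f i.
Proof. by rewrite /upd => /negbTE->. Qed.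

Lemma addr_code_ok d k (m : memory R) : 32 <= d -> d + 2 <= 128 ->
  let m' := run m (addr_code d k) in
  [/\ m'.1 d = m.1 0 + (16 * m.1 d + k), nframe d m m' & m'.2 = m.2].
Proof.
rewrite /addr_code => d1 d2 /=.
have dS : (d == d.+1) = false by apply/eqP; lia.
have d0 : (0 == d) = false by apply/eqP; lia.
split=> //; first by rewrite !(updE, eqxx, dS, d0); lia.
move=> i hi /=.
by rewrite !upd_neq //; lia.
Qed.

Lemma addr_code_straight d k : all straight (addr_code d k).
Proof. by []. Qed.
Local Opaque addr_code.

Lemma ncode_ok A s a d m : sim A s m -> nwf a -> 32 <= d -> d + nheight a <= 128 ->
  let m' := run m (ncode d a) in
  [/\ m'.1 d = neval s a, nframe d m m' & m'.2 = m.2].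
Proof.
elim: a d m => [k|v|a Ha b Hb|a Ha b Hb|k a Ha] d m sm /= wf d1 d2.
- split=> //; first by rewrite upd_eq.
  by move=> i hi /=; rewrite upd_neq //; lia.
- case: sm => _ _ hn _; split=> //.
    by rewrite !updE eqxx; have -> : (v == d) = false by [lia]; rewrite hn.
  by move=> i hi /=; rewrite !upd_neq //; lia.
- case/andP: wf => wa wb; rewrite !foldl_cat.
  have [|ea fa xa] := Ha d m sm wa d1; first by lia.
  set m1 := run m (ncode d a) in ea fa xa *.
  have sm1 : sim A s m1.
    by apply: sim_frame sm _ _ => i hi; rewrite ?xa // fa //; lia.
  have [||eb fb xb] := Hb d.+1 m1 sm1 wb; try lia.
  set m2 := run m1 _ in eb fb xb *.
  have fbd := fb d; rewrite /=.
  rewrite upd_eq eb fbd ?ea; last by lia.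
  split; [by [] | | by rewrite xb].
  by move=> i hi /=; rewrite upd_neq; [rewrite fb ?fa //; lia | lia].
- case/andP: wf => wa wb; rewrite !foldl_cat.
  have [|ea fa xa] := Ha d m sm wa d1; first by lia.
  set m1 := run m (ncode d a) in ea fa xa *.
  have sm1 : sim A s m1.
    by apply: sim_frame sm _ _ => i hi; rewrite ?xa // fa //; lia.
  have [||eb fb xb] := Hb d.+1 m1 sm1 wb; try lia.
  set m2 := run m1 _ in eb fb xb *.
  have fbd := fb d; rewrite /=.
  rewrite upd_eq eb fbd ?ea; last by lia.
  split; [by [] | | by rewrite xb].
  by move=> i hi /=; rewrite upd_neq; [rewrite fb ?fa //; lia | lia].
- case/andP: wf => k16 wa; rewrite !foldl_cat.
  have [|ea fa xa] := Ha d m sm wa d1; first by lia.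
  set m1 := run m (ncode d a) in ea fa xa *.
  have [|eb fb xb] := addr_code_ok k m1 d1; first by lia.
  set m2 := run m1 _ in eb fb xb *.
  have [hA h0 _ [_ harr _]] := sm.
  have m10 : m1.1 0 = A by rewrite fa //; lia.
  rewrite m10 ea in eb.
  have : m2.1 (A + (16 * neval s a + k)) = narr s k (neval s a).
    by rewrite fb ?fa ?harr //; lia.
  rewrite /= upd_eq eb => ->.
  split; [by [] | | by rewrite xb].
  by move=> i hi /=; rewrite upd_neq; [rewrite fb ?fa //; lia | lia].
Qed.

Lemma rcode_ok A s r d m : sim A s m -> rwf r -> 32 <= d -> d + rheight r <= 128 ->
  let m' := run m (rcode d r) in
  [/\ m'.2 d = reval s r, nframe d m m' & rframe d m m'].
Proof.
elim: r d m => [v|a|a Ha b Hb] d m sm /= wf d1 d2.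
- case: sm => _ _ _ [hr _ _]; split.
  + by rewrite !upd_eq hr.
  + by move=> i hi /=; rewrite upd_neq //; lia.
  + by move=> i hi /=; rewrite upd_neq //; lia.
- rewrite !foldl_cat.
  have [|ea fa xa] := ncode_ok sm wf d1; first by lia.
  set m1 := run m (ncode d a) in ea fa xa *.
  have [|eb fb xb] := addr_code_ok 0 m1 d1; first by lia.
  set m2 := run m1 _ in eb fb xb *.
  have [hA h0 _ [_ _ harr]] := sm.
  have m10 : m1.1 0 = A by rewrite fa //; lia.
  rewrite m10 ea addn0 in eb.
  rewrite /= upd_eq eb xb xa harr.
  split=> // i hi /=; first by rewrite fb ?fa.
  by rewrite upd_neq ?xa //; lia.
- case/andP: wf => wa wb; rewrite !foldl_cat.
  have [|ea fa xa] := Ha d m sm wa d1; first by lia.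
  set m1 := run m (rcode d a) in ea fa xa *.
  have sm1 : sim A s m1.
    by apply: sim_frame sm _ _ => i hi; rewrite ?xa ?fa //; lia.
  have [||eb fb xb] := Hb d.+1 m1 sm1 wb; try lia.
  set m2 := run m1 _ in eb fb xb *.
  have xbd := xb d; rewrite /=.
  rewrite upd_eq eb xbd ?ea; last by lia.
  split=> // i hi /=; first by rewrite fb ?fa //; lia.
  by rewrite upd_neq; [rewrite xb ?xa //; lia | lia].
Qed.

(** Jump targets are absolute, so branches are functions of their start address. The else branch
    comes first and ends in [NJle 0 0], which always jumps. *)
Definition cond_code (pre : seq instr) jmp (l : nat) (C1 C2 : nat -> seq instr) :=
  let l2 := (l + size pre).+1 in
  let l1 := (l2 + size (C2 l2)).+1 in
  pre ++ jmp l1 :: C2 l2 ++ NJle 0 0 (l1 + size (C1 l1)) :: C1 l1.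

(** The machine has no move instruction: an integer is copied by adding it to a zeroed cell, and a
    real by an indirect load whose address, 32, is put into integer cell 32. *)
Fixpoint ccode c l : seq instr := match c with
  | Skip => [::]
  | NAssign v a => ncode 32 a ++ [:: NConst v 0; NAdd v v 32]
  | NWrite k i a => ncode 32 i ++ addr_code 32 k ++ ncode 33 a ++ [:: NStore 32 33]
  | RAssign v r => rcode 32 r ++ [:: NConst 32 32; RLoad v 32]
  | IfN a b c1 c2 =>
      cond_code (ncode 32 a ++ ncode 33 b) (NJle 32 33) l (ccode c1) (ccode c2)
  | IfR a b c1 c2 =>
      cond_code (rcode 32 a ++ rcode 33 b) (RJle 32 33) l (ccode c1) (ccode c2)
  | Seq c1 c2 => ccode c1 l ++ ccode c2 (l + size (ccode c1 l))
  end.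

Lemma size_cond_code pre jmp l C1 C2 :
  (forall l l', size (C1 l) = size (C1 l')) -> (forall l l', size (C2 l) = size (C2 l')) ->
  size (cond_code pre jmp l C1 C2) = size pre + size (C1 0) + size (C2 0) + 2.
Proof.
move=> h1 h2; rewrite /cond_code !size_cat /= size_cat /=.
by rewrite (h1 _ 0) (h2 _ 0); lia.
Qed.

(** Relocation changes jump targets only. Hence the code length can serve as a cost that does not
    depend on the position in the program. *)
Lemma size_ccode c l l' : size (ccode c l) = size (ccode c l').
Proof.
elim: c l l' => //= [a b c1 H1 c2 H2|a b c1 H1 c2 H2|c1 H1 c2 H2] l l';
  rewrite ?size_cond_code // !size_cat (H1 _ l') (H2 _ (l' + size (ccode c1 l'))) //.
Qed.

(** Second operands start at cell 33 and scratch space ends at 127, so height 90 fits. Variable 0 is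
    not assignable by integers because that cell keeps the base address. *)
Fixpoint cwf c := match c with
  | Skip => true
  | NAssign v a => [&& 0 < v < 32, nwf a & nheight a <= 90]
  | NWrite k i a => [&& k < 16, nwf i, nheight i <= 90, nwf a & nheight a <= 90]
  | RAssign v r => [&& v < 32, rwf r & rheight r <= 90]
  | IfN a b c1 c2 =>
      [&& nwf a, nheight a <= 90, nwf b, nheight b <= 90, cwf c1 & cwf c2]
  | IfR a b c1 c2 =>
      [&& rwf a, rheight a <= 90, rwf b, rheight b <= 90, cwf c1 & cwf c2]
  | Seq c1 c2 => cwf c1 && cwf c2
  end.

Lemma ncode2_ok A s a b m : sim A s m -> nwf a -> nheight a <= 90 -> nwf b -> nheight b <= 90 ->
  let m' := run m (ncode 32 a ++ ncode 33 b) in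
  [/\ m'.1 32 = neval s a, m'.1 33 = neval s b & sim A s m'].
Proof.
move=> sm wa ha wb hb /=; rewrite foldl_cat.
have [|ea fa xa] := ncode_ok sm wa (leqnn 32); first by lia.
set m1 := run m _ in ea fa xa *.
have sm1 : sim A s m1 by apply: sim_frame sm _ _ => i hi; rewrite ?xa ?fa.
have [||eb fb xb] := ncode_ok (d := 33) sm1 wb => //; first by lia.
split=> //; first by rewrite fb.
by apply: sim_frame sm1 _ _ => i hi; rewrite ?xb // fb //; lia.
Qed.

Lemma rcode2_ok A s a b m : sim A s m -> rwf a -> rheight a <= 90 -> rwf b -> rheight b <= 90 ->
  let m' := run m (rcode 32 a ++ rcode 33 b) in
  [/\ m'.2 32 = reval s a, m'.2 33 = reval s b & sim A s m'].
Proof.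
move=> sm wa ha wb hb /=; rewrite foldl_cat.
have [|ea fa xa] := rcode_ok sm wa (leqnn 32); first by lia.
set m1 := run m _ in ea fa xa *.
have sm1 : sim A s m1 by apply: sim_frame sm _ _ => i hi; rewrite ?xa ?fa.
have [||eb fb xb] := rcode_ok (d := 33) sm1 wb => //; first by lia.
split=> //; first by rewrite xb.
by apply: sim_frame sm1 _ _ => i hi; rewrite ?xb ?fb //; lia.
Qed.

Definition ends A P l k s' l' m := exists k' m',
  [/\ k' <= k, runs P k' (at_ l m) (at_ l' m') & sim A s' m'].

Lemma ends_runs A P l k s' l' m l1 m1 k1 : runs P k1 (at_ l m) (at_ l1 m1) ->
  ends A P l1 k s' l' m1 -> ends A P l (k1 + k) s' l' m.
Proof.
move=> r1 [k2 [m2 [le r2 sm]]]; exists (k1 + k2), m2; split=> //; first by rewrite leq_add2l.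
exact: runs_trans r2.
Qed.

Lemma ends_trans A P l k s' l' m k1 s1 l1 : ends A P l k1 s1 l1 m ->
  (forall m1, sim A s1 m1 -> ends A P l1 k s' l' m1) -> ends A P l (k1 + k) s' l' m.
Proof.
move=> [k2 [m2 [le r2 sm]]] /(_ _ sm) [k3 [m3 [le3 r3 sm3]]].
by exists (k2 + k3), m3; split=> //; [apply: leq_add | apply: runs_trans r3].
Qed.

Lemma ends_le A P l k k' s' l' m : ends A P l k s' l' m -> k <= k' -> ends A P l k' s' l' m.
Proof. by move=> [k2 [m2 [le r sm]]] lek; exists k2, m2; split=> //; apply: leq_trans lek. Qed.

(** The jump and its outcome [b] are abstract so that integer and real comparisons share one
    argument. *)
Lemma cond_code_ok A s s1 s2 m m1 P l pre jmp b C1 C2 :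
  all straight pre -> run m pre = m1 ->
  (forall l' l'', nth Halt P l' = jmp l'' ->
     runs P 1 (at_ l' m1) (at_ (if b then l'' else l'.+1) m1)) ->
  sim A s m1 ->
  (forall l, code_at P l (C1 l) -> ends A P l (size (C1 l)) s1 (l + size (C1 l)) m1) ->
  (forall l, code_at P l (C2 l) -> ends A P l (size (C2 l)) s2 (l + size (C2 l)) m1) ->
  code_at P l (cond_code pre jmp l C1 C2) ->
  ends A P l (size (cond_code pre jmp l C1 C2)) (if b then s1 else s2)
     (l + size (cond_code pre jmp l C1 C2)) m.
Proof.
move=> spre rpre hj sm h1 h2; rewrite /cond_code.
set l2 := (l + size pre).+1; set l1 := (l2 + size (C2 l2)).+1.
move=> /code_at_cat[cpre /code_at_cons[cj /code_at_cat[c2 /code_at_cons[cg c1]]]].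
have := runs_straight m spre cpre; rewrite rpre => r0.
have -> : size (pre ++ jmp l1 :: C2 l2 ++ NJle 0 0 (l1 + size (C1 l1)) :: C1 l1)
    = size pre + (1 + (size (C2 l2) + (1 + size (C1 l1)))).
  by rewrite size_cat /= size_cat /= !add1n.
have -> : l + (size pre + (1 + (size (C2 l2) + (1 + size (C1 l1))))) = l1 + size (C1 l1).
  by rewrite /l1 /l2; lia.
apply: (ends_runs r0); apply: (ends_runs (hj _ _ cj)).
case: b hj => hj; first by apply: ends_le (h1 l1 c1) _; lia.
have [k' [m' [le r sm']]] := h2 l2 c2.
exists (k' + 1), m'; split=> //; first by lia.
exact: runs_trans r (runs_jump m' cg).
Qed.

Lemma ccode_ok A s c m P l : cwf c -> code_at P l (ccode c l) -> sim A s m ->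
  ends A P l (size (ccode c l)) (crun s c) (l + size (ccode c l)) m.
Proof.
elim: c s l m => [|v a|k i a|v r|a b c1 H1 c2 H2|a b c1 H1 c2 H2|c1 H1 c2 H2] s l m.
- by move=> _ _ sm; exists 0, m; rewrite /= addn0.
- case/and3P=> /andP[v0 v1] wa ha /= code sm.
  exists (size (ncode 32 a ++ [:: NConst v 0; NAdd v v 32])), (run m (ncode 32 a ++ [:: NConst v 0; NAdd v v 32])).
  split=> //; first by apply: runs_straight => //; rewrite all_cat ncode_straight.
  rewrite foldl_cat; have [|ea fa xa] := ncode_ok sm wa (leqnn 32); first by lia.
  set m1 := run m _ in ea fa xa *.
  have : sim A s m1 by apply: sim_frame sm _ _ => i hi; rewrite ?xa ?fa.
  case=> [hA h0 hn [hr harr hx]].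
  split=> //=; first by rewrite !upd_neq //; lia.
    move=> v' hv'; rewrite !updE; case: (v' =P v) => [_|_]; last exact: hn.
    by rewrite eqxx; have -> : (32 == v) = false by [lia]; rewrite ea.
  split=> // k i hk; rewrite !upd_neq ?harr //; lia.
- case/and5P=> hk wi hi wa ha /= code sm.
  set C := _ ++ _ in code *.
  exists (size C), (run m C); split=> //.
    by apply: runs_straight => //; rewrite !all_cat !ncode_straight addr_code_straight.
  rewrite /C !foldl_cat; have [|ei fi xi] := ncode_ok sm wi (leqnn 32); first by lia.
  set m1 := run m _ in ei fi xi *.
  have sm1 : sim A s m1 by apply: sim_frame sm _ _ => j hj; rewrite ?xi ?fi.
  have [//|//|eb fb xb] := addr_code_ok (d := 32) k m1.
  set m2 := run m1 _ in eb fb xb *.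
  have sm2 : sim A s m2 by apply: sim_frame sm1 _ _ => j hj; rewrite ?xb ?fb.
  have [//||ea fa xa] := ncode_ok (d := 33) sm2 wa; first by lia.
  set m3 := run m2 _ in ea fa xa *.
  have : sim A s m3 by apply: sim_frame sm2 _ _ => j hj; rewrite ?xa // fa //; lia.
  have : m3.1 32 = A + (16 * neval s i + k).
    by rewrite fa // eb ei; have [_ -> _ _] := sm1.
  move=> e32 [hA h0 hn [hr harr hx]].
  rewrite /= e32 ea; split=> //=; first by rewrite upd_neq //; lia.
    by move=> v hv; rewrite upd_neq ?hn //; lia.
  split=> // k' j hk'; rewrite !updE.
  have [->|kk] := eqVneq k' k.
    rewrite updE; have [->|ji] := eqVneq j (neval s i); first by rewrite eqxx.
    by rewrite -harr // ifF //; lia.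
  by rewrite -harr // ifF //; lia.
- case/and3P=> v1 wr hr /= code sm.
  exists (size (rcode 32 r ++ [:: NConst 32 32; RLoad v 32])), (run m (rcode 32 r ++ [:: NConst 32 32; RLoad v 32])).
  split=> //; first by apply: runs_straight => //; rewrite all_cat rcode_straight.
  rewrite foldl_cat; have [|ea fa xa] := rcode_ok sm wr (leqnn 32); first by lia.
  set m1 := run m _ in ea fa xa *.
  have : sim A s m1 by apply: sim_frame sm _ _ => i hi; rewrite ?xa ?fa.
  case=> [hA h0 hn [hrv harr hx]].
  rewrite /= upd_eq ea; split=> //=; first by move=> v' hv'; rewrite upd_neq ?hn //; lia.
  split=> [v' hv'|k i hk|i].
  + by rewrite !updE; case: eqP => // _; apply: hrv.
  + by rewrite upd_neq ?harr //; lia.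
  + by rewrite upd_neq ?hx //; lia.
- rewrite [cwf _]/= => /and5P[wa ha wb hb /andP[w1 w2]] code sm.
  have [ea eb sm1] := ncode2_ok sm wa ha wb hb.
  apply: (cond_code_ok _ (erefl _) _ sm1) code => //.
  + by rewrite all_cat !ncode_straight.
  + by move=> l' l'' /(runs_njle _) => /(_ R (run m (ncode 32 a ++ ncode 33 b))); rewrite ea eb.
  + by move=> l' c'; apply: H1.
  + by move=> l' c'; apply: H2.
- rewrite [cwf _]/= => /and5P[wa ha wb hb /andP[w1 w2]] code sm.
  have [ea eb sm1] := rcode2_ok sm wa ha wb hb.
  apply: (cond_code_ok _ (erefl _) _ sm1) code => //.
  + by rewrite all_cat !rcode_straight.
  + by move=> l' l'' /(runs_rjle _) => /(_ R (run m (rcode 32 a ++ rcode 33 b))); rewrite ea eb.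
  + by move=> l' c'; apply: H1.
  + by move=> l' c'; apply: H2.
- case/andP=> w1 w2 /= /code_at_cat[cd1 cd2] sm.
  rewrite !size_cat addnA; apply: ends_trans; first exact: H1 sm.
  by move=> m1 sm1; apply: H2.
Qed.

(** * Loops, sequences of stages and timed triples *)

Definition loop_code a b c l : seq instr :=
  let pre := ncode 32 a ++ ncode 33 b in
  let l1 := (l + size pre).+2 in
  pre ++ NJle 32 33 l1 :: NJle 0 0 (l1 + size (ccode c l1)).+1
      :: ccode c l1 ++ [:: NJle 0 0 l].

Definition stage_code g l := match g with
  | Block c => ccode c l
  | Loop a b c => loop_code a b c l
  end.

Fixpoint stages_code gs l : seq instr :=
  if gs is g :: gs' then stage_code g l ++ stages_code gs' (l + size (stage_code g l))
  else [::].

Lemma size_stage_code g l l' : size (stage_code g l) = size (stage_code g l').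
Proof.
case: g => [c|a b c] /=; first exact: size_ccode.
by rewrite /loop_code !size_cat /= !size_cat (size_ccode c _ (l' + (size (ncode 32 a) + size (ncode 33 b))).+2).
Qed.

Definition swf g := match g with
  | Block c => cwf c
  | Loop a b c => [&& nwf a, nheight a <= 90, nwf b, nheight b <= 90 & cwf c]
  end.

(** All jumps inside a command go forward, so one pass executes each instruction at most once and
    the code length bounds its time. *)
Definition cost g := size (stage_code g 0).

(** Total correctness with a time bound: [B] bounds the iterations of every loop among the stages,
    and the successor pays for the final failing test. *)
Definition triple B gs (Pre Post : store R -> Prop) :=
  forall A P l m s, code_at P l (stages_code gs l) -> sim A s m -> Pre s ->
  exists2 s', Post s' & ends A P l (sumn (map cost gs) * B.+1) s' (l + size (stages_code gs l)) m.

Lemma stages_code_cat gs1 gs2 l : stages_code (gs1 ++ gs2) l =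
  stages_code gs1 l ++ stages_code gs2 (l + size (stages_code gs1 l)).
Proof. by elim: gs1 l => [|g gs1 IH] l /=; rewrite ?addn0 // IH size_cat addnA catA. Qed.

Lemma triple_seq B gs1 gs2 Pre Mid Post : triple B gs1 Pre Mid -> triple B gs2 Mid Post ->
  triple B (gs1 ++ gs2) Pre Post.
Proof.
move=> h1 h2 A P l m s; rewrite stages_code_cat => /code_at_cat[c1 c2] sm pre.
have [s1 mid [k' [m1 [le1 r1 sm1]]]] := h1 _ _ _ _ _ c1 sm pre.
have [s2 post e2] := h2 _ _ _ _ _ c2 sm1 mid; exists s2 => //.
rewrite size_cat addnA; apply: ends_le (ends_runs r1 e2) _.
by rewrite map_cat sumn_cat mulnDl leq_add2r.
Qed.

Lemma triple_block B c (Pre Post : store R -> Prop) : cwf c ->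
  (forall s, Pre s -> Post (crun s c)) -> triple B [:: Block c] Pre Post.
Proof.
move=> wc h A P l m s /=; rewrite cats0 addn0 /cost /= (size_ccode c 0 l) => code sm pre.
exists (crun s c); first exact: h.
by apply: ends_le (ccode_ok wc code sm) _; rewrite leq_pmulr.
Qed.

Lemma loop_exit A P l a b c s m : swf (Loop a b c) -> code_at P l (loop_code a b c l) ->
  sim A s m -> neval s b < neval s a ->
  ends A P l (cost (Loop a b c)) s (l + size (loop_code a b c l)) m.
Proof.
case/and5P=> wa ha wb hb wc; rewrite /cost (size_stage_code _ 0 l) /= /loop_code; cbv zeta.
set pre := ncode 32 a ++ ncode 33 b; set l1 := (l + size pre).+2.
move=> /code_at_cat[cpre /code_at_cons[cj /code_at_cons[cx _]]] sm lt_ba.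
have [ea eb sm1] := ncode2_ok sm wa ha wb hb.
have spre : all straight pre by rewrite all_cat !ncode_straight.
exists (size pre + (1 + 1)), (run m pre); split=> //.
  by rewrite [in X in _ <= X]size_cat /=; lia.
apply: runs_trans (runs_straight m spre cpre) _.
apply: runs_trans; first exact: runs_njle cj.
rewrite ea eb leqNgt lt_ba [~~ _]/=.
set l2 := l + size (_ ++ _); have -> : l2 = (l1 + size (ccode c l1)).+1.
  by rewrite /l2 size_cat /= size_cat /= /l1; lia.
exact: runs_jump cx.
Qed.

Lemma loop_iter A P l a b c s m : swf (Loop a b c) -> code_at P l (loop_code a b c l) ->
  sim A s m -> neval s a <= neval s b ->
  ends A P l (cost (Loop a b c)) (crun s c) l m.
Proof.
case/and5P=> wa ha wb hb wc; rewrite /cost (size_stage_code _ 0 l) /= /loop_code; cbv zeta.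
set pre := ncode 32 a ++ ncode 33 b; set l1 := (l + size pre).+2.
move=> /code_at_cat[cpre /code_at_cons[cj /code_at_cons[_ /code_at_cat[cc /code_at_cons[cb _]]]]].
move=> sm le_ab.
have [ea eb sm1] := ncode2_ok sm wa ha wb hb.
have spre : all straight pre by rewrite all_cat !ncode_straight.
have [k' [m' [le r sm']]] := ccode_ok (l := l1) wc cc sm1.
exists (size pre + (1 + (k' + 1))), m'; split=> //.
  by rewrite [in X in _ <= X]size_cat /= size_cat /=; lia.
apply: runs_trans (runs_straight m spre cpre) _.
apply: runs_trans; first exact: runs_njle cj.
by rewrite ea eb le_ab; apply: runs_trans r (runs_jump m' cb).
Qed.

(** The invariant carries a measure that drops in each round, so its initial value bounds the number
    of rounds. *)
Lemma triple_loop a b c (I : store R -> nat -> Prop) B : swf (Loop a b c) ->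
  (forall s k, I s k -> neval s a <= neval s b -> exists2 k', k' < k & I (crun s c) k') ->
  triple B [:: Loop a b c] (fun s => exists2 k, k <= B & I s k)
    (fun s => (exists k, I s k) /\ neval s b < neval s a).
Proof.
move=> wf step A P l m s; rewrite /= cats0 addn0 => code sm [k kB Is].
elim: B k s m kB Is sm => [|B IH] k s m kB Is sm.
  have ltba : neval s b < neval s a.
    by rewrite ltnNge; apply/negP => /(step _ _ Is)[k' kk]; have := leq_trans kk kB.
  by exists s; [split; first by exists k | rewrite muln1; apply: loop_exit].
have [leab|ltba] := leqP (neval s a) (neval s b); last first.
  exists s; first by split; first by exists k.
  by apply: ends_le (loop_exit wf code sm ltba) _; rewrite leq_pmulr.
have [k' kk Is'] := step _ _ Is leab.
have [k1 [m1 [le1 r1 sm1]]] := loop_iter wf code sm leab.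
have [|s2 post e2] := IH k' _ m1 _ Is' sm1; first by rewrite -ltnS (leq_trans kk).
exists s2 => //; rewrite mulnS.
by apply: ends_le (ends_runs r1 e2) _; rewrite leq_add2r.
Qed.

Lemma triple_impl B gs (Pre Pre' Post Post' : store R -> Prop) : triple B gs Pre Post ->
  (forall s, Pre' s -> Pre s) -> (forall s, Post s -> Post' s) -> triple B gs Pre' Post'.
Proof.
move=> h h1 h2 A P l m s code sm /h1 pre.
by have [s' /h2] := h _ _ _ _ _ code sm pre; exists s'.
Qed.

End Language.

(** * Relocating the input and the output *)

Section Relocation.
Variable R : realType.
Local Open Scope nat_scope.

(** Cell 3 is the write pointer and cell 1 holds the stride 16. The integer part of an entry may sit
    in a register [src] other than [j]; the real part is still in place. *)
Definition save_code j src : seq instr := [:: NStore 3 src; RStore 3 j; NAdd 3 3 1].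

(* The input fills the fixed addresses too, so registers are freed by hand:
   cell 3 (always 0) receives A = 16 (2m + 2(n+3)), which exceeds the input
   length, then cells 0..7 are saved above A, and a loop copies the rest. *)
Definition add3_code (bs : seq bool) : seq instr :=
  [seq NAdd 3 3 (if b then 3 else 0) | b <- bs].

(** Address n + 3 holds the last offset, which is 2m. Cell 0, now n + 3, is added twice to it and
    four doublings follow. *)
Definition base_code : seq instr :=
  [:: NConst 3 3; NAdd 0 0 3; NLoad 3 0] ++ add3_code [:: false; false; true; true; true; true].

Definition save0_code : seq instr := [:: NStore 3 1; RStore 3 0; NConst 1 16; NAdd 3 3 1].

(** Entry 3 is saved from the zeroed cell 2, the original cell 3 having contained 0. After eight
    entries the pointer is A + 128, so subtracting 128 recovers A; cells 4 and 7 then hold the next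
    index and the constant 1. *)
Definition saves_code : seq instr :=
  save_code 1 2 ++ save_code 2 0 ++ [:: NConst 2 0] ++ save_code 3 2 ++ save_code 4 4 ++
  save_code 5 5 ++ save_code 6 6 ++ save_code 7 7 ++
  [:: NConst 4 128; NSub 0 3 4; NConst 4 8; NConst 7 1].

Definition copy_body : seq instr :=
  [:: NLoad 5 4; NStore 3 5; RLoad 0 4; RStore 3 0; NAdd 3 3 1; NAdd 4 4 7].

(** The three initial blocks have 39 instructions, so 39 is the loop test and 47 the first address
    after the loop. *)
Definition prologue : seq instr :=
  base_code ++ save0_code ++ saves_code ++ [:: NJle 0 4 47] ++ copy_body ++ [:: NJle 0 0 39].

Section Prologue.
Variables (N : nat -> nat) (X : nat -> R) (n M A : nat).
Hypotheses (n_gt0 : 0 < n) (N0 : N 0 = n) (N3 : N 3 = 0) (NM : N (n + 3) = M).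
Hypothesis A_def : A = 16 * (M + 2 * (n + 3)).
Hypothesis N_out : forall i, A <= i -> N i = 0.

(** Cell 1 must be freed first, to hold the stride, so its content becomes entry 0. Cell 0 is saved
    only third, after [base_code] has raised it by 3; [setup] undoes this. *)
Definition relocated i :=
  if i is 0 then N 1 else if i is 1 then N 2 else if i is 2 then n + 3 else N i.

(** With [j] entries saved, the original integers survive from [q] on and the reals from [q'] on.
    The last clause records that the other fifteen arrays are still zero. *)
Definition saved q q' j (m : memory R) :=
  [/\ m.1 1 = 16, m.1 3 = A + 16 * j, forall i, q <= i < A -> m.1 i = N i,
      forall i, q' <= i < A -> m.2 i = X i
    & [/\ forall i, i < j -> m.1 (A + 16 * i) = relocated i,
          forall i, i < j -> m.2 (A + 16 * i) = X i
        & forall i k, 0 < k < 16 -> m.1 (A + (16 * i + k)) = 0]].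

(** The summand [2 * (n + 3)] is at least 8 for positive [n], which puts the arrays above all
    variables and scratch cells. *)
Lemma A_ge : 128 <= A. Proof. rewrite A_def; lia. Qed.

Lemma add3_code_ok bs (m : memory R) : let m' := run m (add3_code bs) in
  [/\ m'.1 3 = foldl (fun v (b : bool) => v + (if b then v else m.1 0)) (m.1 3) bs,
      forall i, i != 3 -> m'.1 i = m.1 i & m'.2 = m.2].
Proof.
elim: bs m => [|b bs IH] m //=.
set m1 := (_, _); have [e3 ei ex] := IH m1; split=> //.
  by rewrite e3 /m1 /= !updE /=; case: b {m1 e3 ei ex}.
by move=> i i3; rewrite ei // /m1 /= updE (negbTE i3).
Qed.

Lemma base_code_ok : let m := run (N, X) base_code in
  [/\ m.1 3 = A, m.1 0 = n + 3, forall i, i != 0 -> i != 3 -> m.1 i = N i & m.2 = X].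
Proof.
move=> m; rewrite /m /base_code foldl_cat {m}.
set m0 := run _ [:: _; _; _].
have [a3 a0 ai ax] : [/\ m0.1 3 = M, m0.1 0 = n + 3, forall i, i != 0 -> i != 3 -> m0.1 i = N i
    & m0.2 = X].
  rewrite /m0 /= !updE /= N0.
  have -> : (n + 3 == 0) = false by lia.
  have -> : (n + 3 == 3) = false by lia.
  rewrite NM; split=> // i /negbTE i0 /negbTE i3; by rewrite !updE i0 i3.
move: m0 a3 a0 ai ax => m0 a3 a0 ai ax.
have [e3 ei ex] := add3_code_ok [:: false; false; true; true; true; true] m0.
split=> [||i i0 i3|]; [ | by rewrite ei | by rewrite ei // ai | by rewrite ex].
by rewrite e3 /= a3 a0 A_def; lia.
Qed.

Lemma save_code_ok q q' j src m : saved q q' j m -> q' <= j < 8 -> 4 <= q ->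
  src < 8 -> m.1 src = relocated j ->
  let m' := run m (save_code j src) in
  saved q q' j.+1 m' /\ (forall i, i < A -> i != 3 -> m'.1 i = m.1 i).
Proof.
have hA := A_ge.
move=> [e1 e3 en er [ean ear e0]] hj hq hsrc es /=.
have f3 : (3 == A + 16 * j) = false by lia.
have f1 : (1 == A + 16 * j) = false by lia.
rewrite !(updE, e3, f3, f1, e1, es) /=; split; last first.
  by move=> i iA i3; rewrite !upd_neq //; lia.
split=> /=.
- by rewrite !upd_neq //; lia.
- by rewrite upd_eq; lia.
- by move=> i hi; rewrite !upd_neq ?en //; lia.
- by move=> i hi; rewrite !upd_neq ?er //; lia.
- split=> [i hi|i hi|i k hk].
  + rewrite upd_neq; last by lia.
    have [->|ij] := eqVneq i j; first by rewrite upd_eq.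
    by rewrite upd_neq ?ean //; lia.
  + have [->|ij] := eqVneq i j; first by rewrite upd_eq er //; lia.
    by rewrite upd_neq ?ear //; lia.
  + by rewrite !upd_neq ?e0 //; lia.
Qed.

Lemma prologue_init : let m := run (N, X) (base_code ++ save0_code ++ saves_code) in
  [/\ saved 8 8 8 m, m.1 0 = A, m.1 4 = 8 & m.1 7 = 1].
Proof.
have hA := A_ge.
move=> m; rewrite /m foldl_cat {m}; have [a3 a0 ai ax] := base_code_ok.
move: (run (N, X) base_code) a3 a0 ai ax => m0 a3 a0 ai ax.
rewrite /saves_code !foldl_cat.
set m1 := run m0 save0_code.
have [sm1 c0 c2] : [/\ saved 4 1 1 m1, m1.1 0 = n + 3 & m1.1 2 = N 2].
  have f3 : (3 == A) = false by lia.
  split; [ | by rewrite /m1 /= a3 !upd_neq //; lia | by rewrite /m1 /= a3 !upd_neq ?ai //; lia].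
  rewrite /m1 /= !(updE, a3, f3) /= ai // ax.
  split=> //=.
  - by move=> i hi; rewrite !upd_neq ?ai //; lia.
  - by move=> i hi; rewrite !upd_neq //; lia.
  - split=> [i hi|i hi|i k hk].
    + have -> : i = 0 by lia.
      by rewrite muln0 addn0 !updE eqxx !ifF //; lia.
    + have -> : i = 0 by lia.
      by rewrite muln0 addn0 upd_eq.
    + by rewrite !upd_neq ?ai ?N_out //; lia.
move: m1 sm1 c0 c2 => m1 sm1 c0 c2 {m0 a3 a0 ai ax}.
have [//|//|//|//|sm2 f2] := save_code_ok sm1 (j := 1) (src := 2).
move: (run m1 _) sm2 f2 => m2 sm2 f2.
have [//|//|//||sm3 f3] := save_code_ok sm2 (j := 2) (src := 0); first by rewrite f2 ?c0 //; lia.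
move: (run m2 _) sm3 f3 => m3 sm3 f3.
set m4 := run m3 [:: NConst 2 0].
have sm4 : saved 4 1 3 m4.
  case: sm3 => e1 e3 en er [ean ear e0]; split=> //=; first by move=> i hi; rewrite upd_neq ?en //; lia.
  split=> // [i hi|i k hk]; rewrite upd_neq ?ean ?e0 //; lia.
have c42 : m4.1 2 = relocated 3 by rewrite /= N3.
move: m4 sm4 c42 => m4 sm4 c42.
have [//|//|//|//|sm5 _] := save_code_ok sm4 (j := 3) (src := 2).
move: (run m4 _) sm5 => m5 sm5.
have [//|//|//||sm6 _] := save_code_ok sm5 (j := 4) (src := 4).
  by case: sm5 => _ _ -> //; lia.
move: (run m5 _) sm6 => m6 sm6.
have [//|//|//||sm7 _] := save_code_ok sm6 (j := 5) (src := 5).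
  by case: sm6 => _ _ -> //; lia.
move: (run m6 _) sm7 => m7 sm7.
have [//|//|//||sm8 _] := save_code_ok sm7 (j := 6) (src := 6).
  by case: sm7 => _ _ -> //; lia.
move: (run m7 _) sm8 => m8 sm8.
have [//|//|//||sm9 _] := save_code_ok sm8 (j := 7) (src := 7).
  by case: sm8 => _ _ -> //; lia.
move: (run m8 _) sm9 => m9 [e1 e3 en er [ean ear e0]].
rewrite /=.
rewrite !updE /= e3; split=> //; last by lia.
split=> //=.
- by move=> i hi; rewrite !upd_neq ?en //; lia.
- by move=> i hi; rewrite er //; lia.
- by split=> // [i hi|i k hk]; rewrite !upd_neq ?ean ?e0 //; lia.
Qed.

Lemma copy_body_ok j m : saved 8 8 j m -> 8 <= j < A -> m.1 0 = A -> m.1 4 = j -> m.1 7 = 1 ->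
  let m' := run m copy_body in
  [/\ saved 8 8 j.+1 m', m'.1 0 = A, m'.1 4 = j.+1 & m'.1 7 = 1].
Proof.
have hA := A_ge.
move=> [e1 e3 en er [ean ear e0]] hj c0 c4 c7.
have fp i : i < 8 -> (i == A + 16 * j) = false by lia.
have fj i : i < 8 -> (j == i) = false by lia.
rewrite /copy_body /= !(updE, e3, c4, c7, e1, c0, fp, fj) //= addn1.
split=> //.
rewrite en // er //; try lia.
split=> /=.
- by rewrite !upd_neq ?e1 //; lia.
- by rewrite !updE /=; lia.
- by move=> i hi; rewrite !upd_neq ?en //; lia.
- by move=> i hi; rewrite !upd_neq ?er //; lia.
- split=> [i hi|i hi|i k hk].
  + rewrite !(upd_neq _ _ (a := 4)) ?(upd_neq _ _ (a := 3)); try lia.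
    have [->|ij] := eqVneq i j; first by rewrite upd_eq; case: (j) hj => [|[|[|]]].
    by rewrite !upd_neq ?ean //; lia.
  + have [->|ij] := eqVneq i j; first by rewrite upd_eq.
    by rewrite !upd_neq ?ear //; lia.
  + by rewrite !upd_neq ?e0 //; lia.
Qed.

Lemma prologue_ok P : code_at P 0 prologue -> exists k m s,
  [/\ k <= 8 * A, runs P k (MState 0 N X) (at_ (size prologue) m), sim A s m
    & [/\ forall i, i < A -> narr s 0 i = relocated i,
          forall k i, 0 < k < 16 -> narr s k i = 0
        & forall i, i < A -> rarr s i = X i]].
Proof.
have hA := A_ge.
rewrite /prologue => code; move: code.
rewrite !catA => /code_at_cat[/code_at_cat[/code_at_cat[ci cj] cb] cl].
rewrite -!catA in ci cb cl *.
have r0 := runs_straight (N, X) (isT : all straight (base_code ++ save0_code ++ saves_code)) ci.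
have [sm c0 c4 c7] := prologue_init.
move: (run _ _) sm c0 c4 c7 r0 => m0 sm c0 c4 c7 r0.
have {}r0 : runs P 39 (MState 0 N X) (at_ 39 m0) by [].
(* Eight steps per round: the test, six instructions and the jump back; one more for the final
   test. *)
suff loop d j m : d = A - j -> 8 <= j <= A -> saved 8 8 j m -> m.1 0 = A -> m.1 4 = j -> m.1 7 = 1 ->
    exists m', [/\ runs P (8 * d + 1) (at_ 39 m) (at_ 47 m'), saved 8 8 A m' & m'.1 0 = A].
  have [|m [r1 [e1 e3 en er [ean ear e0]] m0A]] := loop (A - 8) 8 m0 erefl _ sm c0 c4 c7.
    by lia.
  exists (39 + (8 * (A - 8) + 1)), m.
  exists (Store m.1 m.2 (fun k i => m.1 (A + (16 * i + k))) (fun i => m.2 (A + 16 * i))).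
  split=> //=; first by lia.
    exact: runs_trans r0 r1.
  by split=> [i hi|k i hk|i hi]; [rewrite addn0 ean | apply: e0 | apply: ear].
elim: d j m => [|d IH] j m dE hj smj cj0 cj4 cj7.
  have jA : j = A by lia.
  exists m; rewrite -jA in smj *; split=> //; last by rewrite jA.
  have [cjl _] := code_at_cons cj; have := runs_njle m cjl.
  by rewrite cj0 cj4 jA leqnn; apply.
have [cjl _] := code_at_cons cj; have := runs_njle m cjl.
rewrite cj0 cj4 ifF; last by lia.
move=> r1.
have r2 := runs_straight m (isT : all straight copy_body) cb.
have [|sm' c0' c4' c7'] := copy_body_ok smj _ cj0 cj4 cj7; first by lia.
have [||m' [r3 sm3 m'0]] := IH j.+1 (run m copy_body) _ _ sm' c0' c4' c7'; try lia.
have [cll _] := code_at_cons cl.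
exists m'; split=> //.
have -> : 8 * d.+1 + 1 = 1 + (6 + (1 + (8 * d + 1))) by lia.
apply: runs_trans r1 _; apply: runs_trans r2 _; apply: runs_trans r3.
exact: runs_jump cll.
Qed.

End Prologue.

(** The low cells are filled last and downwards, using only cell 0 as pointer and cell 1 as stride,
    so that no register is overwritten while in use. *)
Definition unload_code q : seq instr :=
  flatten [seq [:: NLoad c 0; NSub 0 0 1] | c <- rev (iota 2 q)].

(** 136 = 16 * 8 + 8 is the offset of entry 8 of the output array; offset 8 is its entry 0, the
    output length, loaded into cell 5. *)
Definition epilogue_init : seq instr :=
  [:: NConst 1 16; NConst 2 136; NAdd 3 0 2; NConst 4 8; NConst 7 1; NConst 2 8;
      NAdd 5 0 2; NLoad 5 5].

Definition epilogue_body : seq instr := [:: NLoad 6 3; NStore 4 6; NAdd 3 3 1; NAdd 4 4 7].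

(* The last three instructions exchange cells 0 and 1. *)
Definition epilogue_end : seq instr :=
  [:: NConst 2 120; NAdd 0 0 2] ++ unload_code 6 ++
  [:: NSub 1 0 1; NLoad 1 1; NLoad 0 0; NAdd 0 0 1; NSub 1 0 1; NSub 0 0 1].

Definition epilogue l : seq instr :=
  epilogue_init ++ [:: NJle 4 5 (l + 10); NJle 0 0 (l + 15)] ++ epilogue_body ++
  [:: NJle 0 0 (l + 8)] ++ epilogue_end.

Lemma unload_code_ok A (out : nat -> nat) q (m : memory R) :
  128 <= A -> q <= 6 -> m.1 1 = 16 -> m.1 0 = A + (16 * q.+1 + 8) ->
  (forall i, m.1 (A + (16 * i + 8)) = out i) ->
  let m' := run m (unload_code q) in
  [/\ m'.1 1 = 16, m'.1 0 = A + 24, forall i, 2 <= i < q + 2 -> m'.1 i = out i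
    & forall i, q + 2 <= i -> m'.1 i = m.1 i].
Proof.
move=> hA; elim: q m => [|q IH] m hq e1 e0 ho.
  by split=> //= i; lia.
have -> : unload_code q.+1 = [:: NLoad (2 + q) 0; NSub 0 0 1] ++ unload_code q.
  by rewrite /unload_code -[q.+1]addn1 iotaD rev_cat map_cat flatten_cat.
rewrite foldl_cat [run m _]/=.
have q0 : (0 == 2 + q) = false by lia.
have q1 : (1 == 2 + q) = false by lia.
rewrite !(updE, q0, q1, e0, e1, ho).
set m1 := (_, _); have [//||//||f1 f0 fi ff] := IH m1; first by lia.
- by rewrite /m1 /= upd_neq // updE q1.
- by rewrite /m1 /= upd_eq; lia.
- by move=> i; rewrite /m1 /= !upd_neq ?ho //; lia.
split=> // i hi.
  have [iq|iq] := ltnP i (q + 2); first by rewrite fi //; lia.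
  have -> : i = 2 + q by lia.
  rewrite ff; last by lia.
  by rewrite /m1 /= upd_neq ?upd_eq; [congr out | ]; lia.
rewrite ff; last by lia.
by rewrite /m1 /= !upd_neq //; lia.
Qed.

Lemma epilogue_ok A (s : store R) m P l k : sim A s m -> narr s 8 0 = k -> k < A ->
  code_at P l (epilogue l) -> exists k' m',
  [/\ k' <= 30 + 8 * k, runs P k' (at_ l m) (at_ (l + size (epilogue l)) m')
    & forall i, i <= k -> m'.1 i = narr s 8 i].
Proof.
move=> [hA h0 _ [_ harr _]] hk kA; rewrite /epilogue.
move=> /code_at_cat[ci /code_at_cat[/code_at_cons[cj /code_at_cons[cx _]]
  /code_at_cat[cb /code_at_cat[/code_at_cons[cl _] ce]]]].
have r0 := runs_straight m (isT : all straight epilogue_init) ci.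
have o0 i : m.1 (A + (16 * i + 8)) = narr s 8 i by rewrite harr.
pose inv c (m : memory R) := [/\ [/\ m.1 0 = A, m.1 1 = 16, m.1 4 = c, m.1 5 = k & m.1 7 = 1],
  m.1 3 = A + (16 * c + 8), forall i, 8 <= i < c -> m.1 i = narr s 8 i
  & forall i, m.1 (A + (16 * i + 8)) = narr s 8 i].
have i0 : inv 8 (run m epilogue_init).
  rewrite /epilogue_init (foldl_cat _ _ [:: _; _; _; _; _] [:: _; _; _]).
  set m1 := run m [:: _; _; _; _; _].
  have [e0 e1 e3 e4 e7] : [/\ m1.1 0 = A, m1.1 1 = 16, m1.1 3 = A + 136, m1.1 4 = 8 & m1.1 7 = 1].
    by rewrite /m1 /= !updE /= h0.
  have ee i : 8 <= i -> m1.1 i = m.1 i by move=> hi; rewrite /m1 /= !upd_neq //; lia.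
  move: m1 e0 e1 e3 e4 e7 ee => m1 e0 e1 e3 e4 e7 ee.
  have f8 i : i < 8 -> (A + 8 == i) = false by lia.
  have o8 : m1.1 (A + 8) = k by rewrite ee -?hk -?o0 ?muln0 ?add0n //; lia.
  rewrite /inv /= !(updE, e0, e1, e3, e4, e7, f8, o8) //=; split=> //; first by move=> i; lia.
  by move=> i; rewrite !upd_neq ?ee ?o0 //; lia.
have {}r0 : runs P 8 (at_ l m) (at_ (l + 8) (run m epilogue_init)) by [].
suff loop d c m1 : d = k.+1 - c -> 8 <= c -> inv c m1 ->
    exists c' m', [/\ runs P (6 * d + 2) (at_ (l + 8) m1) (at_ (l + 15) m'), inv c' m' & k < c'].
  have [//|c [m1 [r1 [[e0 e1 e4 e5 e7] e3 eo eh] kc]]] := loop (k.+1 - 8) 8 _ erefl _ i0.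
  have ce' : code_at P (l + 15) epilogue_end.
    by move: ce; rewrite /= -!addnA.
  have r2 := runs_straight m1 (isT : all straight epilogue_end) ce'.
  exists (8 + (6 * (k.+1 - 8) + 2 + size epilogue_end)), (run m1 epilogue_end).
  split; first by rewrite /=; lia.
    apply: runs_trans r0 _; apply: runs_trans r1 _; move: r2.
    by congr (runs _ _ _ (at_ _ _)); rewrite !size_cat /=; lia.
  rewrite /epilogue_end 2!foldl_cat.
  set m2 := run m1 [:: _; _]; have [|||f1 f0 fi ff] := @unload_code_ok A (narr s 8) 6 m2 hA isT.
  - by rewrite /m2 /= !updE /= e1.
  - by rewrite /m2 /= !updE /= e0; lia.
  - by move=> i; rewrite /m2 /= !upd_neq ?eh //; lia.
  move: (run m2 _) f1 f0 fi ff => m3 f1 f0 fi ff.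
  have fh i : m3.1 (A + (16 * i + 8)) = narr s 8 i.
    by rewrite ff ?/m2 /= ?upd_neq ?eh //; lia.
  have g1 : m3.1 (A + 24) = narr s 8 1 by rewrite -fh.
  have g0 : m3.1 (A + 8) = narr s 8 0 by rewrite -fh.
  rewrite (foldl_cat _ _ [:: _; _; _] [:: _; _; _]); set m4 := run m3 [:: _; _; _].
  have [h4 h41 h42] : [/\ m4.1 0 = narr s 8 1, m4.1 1 = narr s 8 0
      & forall i, 2 <= i -> m4.1 i = m3.1 i].
    have e8 : A + 24 - 16 = A + 8 by lia.
    have f8 i : i < 8 -> (A + 8 == i) = false by lia.
    have f24 i : i < 8 -> (A + 24 == i) = false by lia.
    rewrite /m4 /= !(updE, f0, f1, e8, f8, f24, g1, g0) //=; split=> // i hi.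
    by rewrite !upd_neq //; lia.
  move: m4 h4 h41 h42 => m4 h4 h41 h42; rewrite /= !(updE, h4, h41) /=.
  move=> i ik; rewrite !updE.
  have [->|i0'] := eqVneq i 0; first by lia.
  have [->|i1] := eqVneq i 1; first by lia.
  have [i8|i8] := ltnP i 8; first by rewrite h42 ?fi //; lia.
  by rewrite h42 ?ff // /m2 /= ?upd_neq ?eo //; lia.
elim: d c m1 => [|d IH] c m1 dE c8 ic.
  case: (ic) => -[e0 e1 e4 e5 e7] _ _ _.
  exists c, m1; split=> //; last by lia.
  have := runs_njle m1 cj; rewrite e4 e5 ifF; last by lia.
  by move=> r1; apply: (runs_trans (k1 := 1) r1); apply: runs_jump cx.
case: (ic) => -[e0 e1 e4 e5 e7] e3 eo eh.
have cc' : inv c.+1 (run m1 epilogue_body).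
  have cA : c < A by lia.
  have fc i : i < 8 -> (i == c) = false by lia.
  rewrite /inv /epilogue_body /= !(updE, e0, e1, e3, e4, e5, e7, fc, eh) //=.
  split=> /=.
  - by split; rewrite ?upd_neq ?e0 ?e1 ?e5 ?e7 //; lia.
  - by lia.
  - move=> i hi; rewrite !(upd_neq _ _ (a := 4)) ?(upd_neq _ _ (a := 3)); try lia.
    have [->|ij] := eqVneq i c; first by rewrite upd_eq.
    by rewrite !upd_neq ?eo //; lia.
  - by move=> i; rewrite !upd_neq ?eh //; lia.
have [||c' [m' [r3 ic' kc]]] := IH c.+1 _ _ _ cc'; try lia.
exists c', m'; split=> //.
have -> : 6 * d.+1 + 2 = 1 + (4 + (1 + (6 * d + 2))) by lia.
have := runs_njle m1 cj; rewrite e4 e5 ifT; last by lia.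
move=> r1; apply: runs_trans r1 _.
have cb' : code_at P (l + 10) epilogue_body by move: cb; rewrite /= -!addnA.
apply: runs_trans (runs_straight m1 (isT : all straight epilogue_body) cb') _.
have cl' : nth Halt P (l + 10 + size epilogue_body) = NJle 0 0 (l + 8).
  by move: cl; rewrite /= -!addnA.
exact: runs_trans (runs_jump _ cl') r3.
Qed.

End Relocation.

(** * The algorithm *)

(* Variables: 1 n, 2 s, 3 t, 4 2m, 5 queue head, 6 queue tail, 7 arc index,
   8 and 9 vertices, 10 candidate found, 11 and 12 its ends, 13.. output;
   real variables: 1 d(s,t), 2 best value.
   Arrays: 0 input, 1-3 and 4-6 parent, label, depth for s and t, 7 queue, 8 output. *)
Section Program.
Local Open Scope nat_scope.

Definition eoff a := EIdx 0 (EAdd (EConst 3) a).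
Definition enbr a := EIdx 0 (EAdd (EAdd (EVar 1) (EConst 4)) a).
Definition eds a := RIdx (EAdd (EVar 4) a).
Definition edt a := RIdx (EAdd (EAdd (EVar 4) (EVar 1)) a).
Definition esucc a := EAdd a (EConst 1).
Definition seqs := foldr Seq Skip.

Definition setup : cmd := seqs
  [:: NAssign 1 (ESub (EIdx 0 (EConst 2)) (EConst 3)); NAssign 2 (EIdx 0 (EConst 0));
      NAssign 3 (EIdx 0 (EConst 1)); NAssign 4 (eoff (EVar 1)); RAssign 1 (eds (EVar 3))].

Definition search_init root lab dep : cmd := seqs
  [:: NWrite dep (EVar root) (EConst 1); NWrite lab (EVar root) (EVar root);
      NWrite 7 (EConst 0) (EVar root); NAssign 5 (EConst 0); NAssign 6 (EConst 1);
      NAssign 7 (eoff (EVar root))].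

Definition visit par lab dep : cmd := seqs
  [:: NWrite dep (EVar 9) (esucc (EIdx dep (EVar 8))); NWrite par (EVar 9) (EVar 8);
      IfR (RSum (eds (EVar 9)) (edt (EVar 9))) (RVar 1)
        (NWrite lab (EVar 9) (EVar 9)) (NWrite lab (EVar 9) (EIdx lab (EVar 8)));
      NWrite 7 (EVar 6) (EVar 9); NAssign 6 (esucc (EVar 6))].

(** The nested loops of a graph search are merged into one: a round either inspects one arc of the
    queue head or advances the head. *)
Definition search_body (d : nexp -> rexp) par lab dep : cmd := seqs
  [:: NAssign 8 (EIdx 7 (EVar 5));
      IfN (esucc (EVar 7)) (eoff (esucc (EVar 8)))
        (seqs [:: NAssign 9 (enbr (EVar 7));
           IfN (EIdx dep (EVar 9)) (EConst 0)
             (IfR (RSum (d (EVar 8)) (RIdx (EVar 7))) (d (EVar 9)) (visit par lab dep) Skip)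
             Skip;
           NAssign 7 (esucc (EVar 7))])
        (seqs [:: NAssign 5 (esucc (EVar 5)); NAssign 7 (eoff (EIdx 7 (EVar 5)))])].

Definition search root d par lab dep : seq stage :=
  [:: Block (search_init root lab dep);
      Loop (esucc (EVar 5)) (EVar 6) (search_body d par lab dep)].

Definition ecand x y := RSum (RSum (eds x) (RIdx (EVar 7))) (edt y).

Definition keep : cmd := seqs
  [:: RAssign 2 (ecand (EVar 9) (EVar 8)); NAssign 11 (EVar 9); NAssign 12 (EVar 8);
      NAssign 10 (EConst 1)].

Definition select_init : cmd := seqs
  [:: NAssign 7 (EConst 0); NAssign 9 (EConst 0); NAssign 10 (EConst 0)].

(** With truncated subtraction this is the absolute difference, zero exactly when the values are
    equal. *)
Definition ediff a b := EAdd (ESub a b) (ESub b a).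

Definition select_body : cmd :=
  IfN (esucc (EVar 7)) (eoff (esucc (EVar 9)))
    (seqs [:: NAssign 8 (enbr (EVar 7));
       IfN (ediff (EIdx 2 (EVar 9)) (EIdx 5 (EVar 8))) (EConst 0) Skip
       (IfR (ecand (EVar 9) (EVar 8)) (RVar 1) Skip
       (IfR (ecand (EVar 8) (EVar 9)) (RVar 1) Skip
       (IfN (EVar 10) (EConst 0) keep
       (IfR (RVar 2) (ecand (EVar 9) (EVar 8)) Skip keep))));
       NAssign 7 (esucc (EVar 7))])
    (NAssign 9 (esucc (EVar 9))).

(** The path is written from position [dps x] down to 1 and then upwards from the next position.
    Without a candidate, the values 0, 0, 1 of variables 13, 14, 15 make both output loops exit at
    once. *)
Definition output_init : cmd := seqs
  [:: NAssign 13 (EConst 0); NAssign 14 (EConst 0);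
      IfN (EConst 1) (EVar 10)
        (seqs [:: NAssign 13 (EIdx 3 (EVar 11)); NAssign 8 (EVar 11);
           NAssign 14 (EAdd (EVar 13) (EIdx 6 (EVar 12)))]) Skip;
      NAssign 15 (esucc (EVar 13));
      NWrite 8 (EConst 0) (EVar 14)].

Definition output_s : cmd := seqs
  [:: NWrite 8 (EVar 13) (EVar 8); NAssign 8 (EIdx 1 (EVar 8));
      NAssign 13 (ESub (EVar 13) (EConst 1))].

Definition output_t : cmd := seqs
  [:: NWrite 8 (EVar 15) (EVar 8); NAssign 8 (EIdx 4 (EVar 8)); NAssign 15 (esucc (EVar 15))].

Definition algorithm : seq stage :=
  [:: Block setup] ++ search 2 eds 1 2 3 ++ search 3 edt 4 5 6 ++
  [:: Block select_init; Loop (esucc (EVar 9)) (EVar 1) select_body;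
      Block output_init; Loop (EConst 1) (EVar 13) output_s;
      Block (NAssign 8 (EVar 12)); Loop (EVar 15) (EVar 14) output_t].

End Program.

(** * Correctness of the two searches *)

Section Verification.
Variables (R : realType) (n : nat) (e : rel 'I_n) (w : 'I_n -> 'I_n -> R).
Variables (s t : 'I_n) (ds dt : 'I_n -> R) (off nb : nat -> nat) (wt : nat -> R).
Local Open Scope nat_scope.
Implicit Type st : store R.

Hypothesis off0 : off 0 = 0.
Hypothesis off_mono : {homo off : i j / i <= j}.
Hypothesis arcs : forall (x : 'I_n) j, off x <= j < off x.+1 ->
  exists y : 'I_n, [/\ nb j = y, e x y & wt j = w x y].
Hypothesis arc_index : forall x y : 'I_n, e x y ->
  exists j, [/\ off x <= j < off x.+1, nb j = y & wt j = w x y].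

Record input st : Prop := Input {
  in_n : nvar st 1 = n; in_s : nvar st 2 = s; in_t : nvar st 3 = t;
  in_m : nvar st 4 = off n; in_dst : rvar st 1 = ds t;
  in_off : forall i, i <= n -> narr st 0 (3 + i) = off i;
  in_nb : forall j, j < off n -> narr st 0 (n + 4 + j) = nb j;
  in_wt : forall j, j < off n -> rarr st j = wt j;
  in_ds : forall v : 'I_n, rarr st (off n + v) = ds v;
  in_dt : forall v : 'I_n, rarr st (off n + n + v) = dt v }.

Lemma input_frame st st' : (forall i, 0 < i < 5 -> nvar st' i = nvar st i) ->
  rvar st' 1 = rvar st 1 -> narr st' 0 = narr st 0 -> rarr st' = rarr st ->
  input st -> input st'.
Proof.
by move=> hn hr ha hx [i1 i2 i3 i4 i5 i6 i7 i8 i9 i10]; split; rewrite ?hn ?hr ?ha ?hx.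
Qed.

Lemma crun_ifN st a b c1 c2 : crun st (IfN a b c1 c2) =
  if neval st a <= neval st b then crun st c1 else crun st c2.
Proof. by []. Qed.

Lemma crun_ifR st a b c1 c2 : crun st (IfR a b c1 c2) =
  if (reval st a <= reval st b)%R then crun st c1 else crun st c2.
Proof. by []. Qed.

Lemma crun_seqs st c cs : crun st (seqs (c :: cs)) = crun (crun st c) (seqs cs).
Proof. by []. Qed.

Lemma crun_nil st : crun st (seqs [::]) = st.
Proof. by []. Qed.

Lemma off_lt (v : 'I_n) j : j < off v.+1 -> j < off n.
Proof. by move=> h; apply: leq_trans h _; apply: off_mono. Qed.

Notation inV := (onD t ds dt).

Definition tree_rep (a : nat -> nat -> nat) par lab dep (root : 'I_n) (P L : 'I_n -> 'I_n) (D : 'I_n -> nat) :=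
  [/\ forall v : 'I_n, v != root -> a par v = P v,
      forall v : 'I_n, a lab v = L v & forall v : 'I_n, a dep v = D v].

Section Search.
Variables (root : 'I_n) (d : 'I_n -> R) (rootv par lab dep : nat) (dE : nexp -> rexp).
Hypothesis d_dist : forall v, is_dist e w root v (d v).
Hypothesis w_gt0 : forall x y, e x y -> (0 < w x y)%R.
Hypothesis root_inV : inV root.
Hypothesis rootv_bound : 0 < rootv < 5.
Hypothesis rootvE : forall st, input st -> nvar st rootv = root.
Hypothesis dE_eval : forall st a (v : 'I_n), input st -> neval st a = v -> reval st (dE a) = d v.
Hypothesis arrays_uniq : uniq [:: 0; 7; par; lab; dep].
Variable st0 : store R.

(** [Q] is the whole list of vertices ever queued. It is a ghost value: the program recognises
    membership by a nonzero depth. *)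
Record partial_tree (Q : seq 'I_n) st : Prop := PartialTree {
  pt_input : input st;
  pt_tail : nvar st 6 = size Q;
  pt_queue : forall i, i < size Q -> narr st 7 i = nth root Q i;
  pt_fresh : forall v : 'I_n, v \notin Q -> narr st dep v = 0;
  pt_dep_gt0 : forall v : 'I_n, v \in Q -> 0 < narr st dep v;
  pt_lab : forall v : 'I_n, v \in Q -> narr st lab v < n;
  pt_root : narr st dep root = 1 /\ narr st lab root = root;
  pt_par : forall v, v \in Q -> v != root -> exists u : 'I_n,
    [/\ u \in Q, e u v /\ (d u + w u v <= d v)%R, narr st par v = u,
        narr st dep v = (narr st dep u).+1
      & narr st lab v = if inV v then val v else narr st lab u];
  pt_frame : forall k, k \notin [:: 7; par; lab; dep] -> narr st k = narr st0 k }.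

Definition closed_upto (Q : seq 'I_n) h j :=
  [/\ uniq Q, root \in Q, h <= size Q,
      forall i v, i < h -> e (nth root Q i) v ->
        (d (nth root Q i) + w (nth root Q i) v <= d v)%R -> v \in Q
    & h < size Q -> off (nth root Q h) <= j <= off (nth root Q h).+1 /\
        forall i v, off (nth root Q h) <= i < j -> nb i = val v ->
          (d (nth root Q h) + wt i <= d v)%R -> v \in Q].

(** Each vertex not yet passed by the queue head, discovered or not, is charged its degree plus one
    for moving the head; arcs already inspected at the head are deducted. The initial value is 2m +
    n. *)
Definition work (Q : seq 'I_n) h j :=
  \sum_(v : 'I_n | v \notin take h Q) (off v.+1 - off v + 1)
  - (if h < size Q then j - off (nth root Q h) else 0).

Lemma partial_tree_frame Q st st' : partial_tree Q st ->
  (forall i, i < 7 -> nvar st' i = nvar st i) -> rvar st' = rvar st ->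
  narr st' = narr st -> rarr st' = rarr st -> partial_tree Q st'.
Proof.
case=> h1 h2 h3 h4 h5 h6 h7 h8 h9 en er ea ex.
split; rewrite ?ea ?en //; apply: input_frame h1; rewrite ?er ?ea //.
by move=> i hi; rewrite en //; lia.
Qed.

Lemma arrays_neq : [/\ [/\ (0 == 7) = false, (0 == par) = false, (0 == lab) = false & (0 == dep) = false],
  [/\ (7 == par) = false, (7 == lab) = false & (7 == dep) = false]
  & [/\ (par == lab) = false, (par == dep) = false & (lab == dep) = false]].
Proof.
move: arrays_uniq; rewrite /= !inE !negb_or.
by move=> /and5P[/and4P[_ /negbTE-> /negbTE-> /negbTE->]
  /and3P[/negbTE-> /negbTE-> /negbTE->] /andP[/negbTE-> /negbTE->] /negbTE-> _].
Qed.

Lemma visit_store Q st (u v : 'I_n) : partial_tree Q st -> nvar st 8 = u -> nvar st 9 = v ->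
  let st' := crun st (visit par lab dep) in
  [/\ nvar st' = upd (nvar st) 6 (size Q).+1 /\ rvar st' = rvar st /\ rarr st' = rarr st,
      narr st' dep = upd (narr st dep) v (narr st dep u).+1,
      narr st' par = upd (narr st par) v u,
      narr st' lab = upd (narr st lab) v (if inV v then val v else narr st lab u)
    & narr st' 7 = upd (narr st 7) (size Q) v /\
      forall k, k \notin [:: 7; par; lab; dep] -> narr st' k = narr st k].
Proof.
move=> pt eu ev.
have [i1 i2 i3 i4 i5 i6 i7 i8 i9 i10] := pt_input pt.
have [[f1 f2 f3 f4] [f5 f6 f7] [f8 f9 f10]] := arrays_neq.
have g1 : (par == 7) = false by rewrite eq_sym.
have g2 : (lab == 7) = false by rewrite eq_sym.
have g3 : (dep == 7) = false by rewrite eq_sym.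
have g4 : (lab == par) = false by rewrite eq_sym.
have g5 : (dep == par) = false by rewrite eq_sym.
have g6 : (dep == lab) = false by rewrite eq_sym.
rewrite /visit /= eu ev i4 i1 i5 i9 i10 -/(inV v).
case: (inV v) => /=; rewrite (pt_tail pt) ?eu ?ev addn1; split;
  rewrite ?(updE, eqxx, f5, f6, f7, f8, f9, f10, g1, g2, g3, g4, g5, g6) ?addn1 //=; split=> // k;
  by rewrite !inE !negb_or => /and4P[/negbTE k1 /negbTE k2 /negbTE k3 /negbTE k4];
     rewrite !updE k1 k2 k3 k4.
Qed.

Lemma visit_ok Q st (u v : 'I_n) : partial_tree Q st -> nvar st 8 = u -> nvar st 9 = v ->
  u \in Q -> v \notin Q -> root \in Q -> e u v -> (d u + w u v <= d v)%R ->
  partial_tree (rcons Q v) (crun st (visit par lab dep)).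
Proof.
move=> pt eu ev uQ vQ rQ euv tight.
have [[en [er ex]] ed ep el [eq ek]] := visit_store pt eu ev.
move: (crun _ _) en er ex ed ep el eq ek => st' en er ex ed ep el eq ek.
have [[f1 f2 f3 f4] _ _] := arrays_neq.
have neq (x : 'I_n) : x \in Q -> (val x == val v) = false.
  by move=> xQ; apply: contraNF vQ => /eqP/val_inj <-.
have [h1 h2 h3 h4 h5 h6 [h7 h7'] h8 h9] := pt.
split.
- apply: input_frame h1; rewrite ?er ?ex //.
    by move=> i hi; rewrite en upd_neq //; lia.
  by rewrite ek // !inE f2 f3 f4.
- by rewrite en upd_eq size_rcons.
- move=> i; rewrite size_rcons ltnS eq updE nth_rcons => iQ.
  by case: eqVneq => [->|iq]; rewrite ?ltnn ?eqxx // ltn_neqAle iq iQ h3 // ltn_neqAle iq.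
- move=> x; rewrite mem_rcons inE negb_or => /andP[xv xQ].
  by rewrite ed upd_neq ?h4.
- move=> x; rewrite mem_rcons inE ed updE => /orP[/eqP->|xQ]; first by rewrite eqxx.
  by rewrite neq ?h5.
- move=> x; rewrite mem_rcons inE el updE => /orP[/eqP->|xQ].
    by rewrite eqxx; case: ifP => _; [apply: ltn_ord | apply: h6].
  by rewrite neq ?h6.
- by rewrite ed el !updE neq.
- move=> x; rewrite mem_rcons inE ed el ep => /orP[/eqP-> _|xQ xr].
    exists u; rewrite mem_rcons inE uQ orbT !updE eqxx neq //.
  have [y [yQ ty py dy ly]] := h8 x xQ xr.
  by exists y; rewrite mem_rcons inE yQ orbT !updE !neq.
- by move=> k hk; rewrite ek // h9.
Qed.

Lemma search_body_ok st k : (exists Q h j, [/\ partial_tree Q st, closed_upto Q h j,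
    nvar st 5 = h, nvar st 7 = j & k = work Q h j]) ->
  neval st (esucc (EVar 5)) <= neval st (EVar 6) ->
  exists2 k', k' < k & exists Q h j, let st' := crun st (search_body dE par lab dep) in
    [/\ partial_tree Q st', closed_upto Q h j, nvar st' 5 = h, nvar st' 7 = j & k' = work Q h j].
Proof.
move=> [Q [h [j [pt [uQ rQ hQ cl cur] eh ej ->]]]].
rewrite [neval _ _]/= [neval _ (EVar _)]/= eh (pt_tail pt) addn1 => hlt.
have [/andP[j0 j1] jcl] := cur hlt.
set u := nth root Q h in j0 j1 jcl.
have uin : u \in Q by apply: mem_nth.
have utake : u \notin take h Q.
  rewrite /u -[Q in nth _ Q](cat_take_drop h) nth_cat size_takel // ltnn subnn.
  have := uQ; rewrite -[Q in uniq Q](cat_take_drop h) cat_uniq => /and3P[_ /hasPn H _].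
  by apply: H; rewrite (drop_nth root hlt) inE eqxx.
have sumE : \sum_(v : 'I_n | v \notin take h Q) (off v.+1 - off v + 1) =
    (off u.+1 - off u + 1) + \sum_(v : 'I_n | (v \notin take h Q) && (v != u)) (off v.+1 - off v + 1).
  by rewrite (bigD1 u).
set st1 := Store (upd (nvar st) 8 (narr st 7 (nvar st 5))) (rvar st) (narr st) (rarr st).
have eu : nvar st1 8 = u by rewrite /= upd_eq eh (pt_queue pt).
have pt1 : partial_tree Q st1.
  by apply: partial_tree_frame pt _ _ _ _ => // i i7; rewrite /= upd_neq // neq_ltn (leq_trans i7).
have offE : narr st1 0 (3 + (u + 1)) = off u.+1 by rewrite (in_off (pt_input pt1)) addn1.
rewrite /search_body crun_seqs -[crun st (NAssign _ _)]/st1.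
have e5 : nvar st1 5 = h by exact: eh.
have e7 : nvar st1 7 = j by exact: ej.
move: st1 eu pt1 offE e5 e7 => st1 eu pt1 offE e5 e7 {st pt eh ej}.
rewrite crun_seqs crun_ifN [neval _ _]/= [neval _ (eoff _)]/= eu e7 offE crun_nil.
have [jlt|jge] := leqP (j + 1) (off u.+1); last first.
  have jE : j = off u.+1 by lia.
  set st2 := crun st1 _.
  have en2 : nvar st2 5 = h.+1 by rewrite -e5 -[RHS]addn1.
  (* Past the tail the queue cell read here may be stale, but then the loop ends and the arc index
     no longer matters. *)
  have eo2 : h.+1 < size Q -> nvar st2 7 = off (nth root Q h.+1).
    move=> hq; rewrite -[nvar st2 7]/(narr st1 0 (3 + narr st1 7 (nvar st1 5 + 1))).
    rewrite e5 addn1 (pt_queue pt1) //.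
    by rewrite (in_off (pt_input pt1)) // ltnW.
  have pt2 : partial_tree Q st2.
    case: pt1 => k1 k2 k3 k4 k5 k6 k7 k8 k9; split=> //=.
    by apply: input_frame k1 => //= i i5; rewrite !upd_neq //; lia.
  exists (work Q h.+1 (nvar st2 7)).
    rewrite /work hlt (take_nth root hlt) sumE jE -/u.
    have -> : \sum_(v : 'I_n | v \notin rcons (take h Q) u) (off v.+1 - off v + 1) =
       \sum_(v : 'I_n | (v \notin take h Q) && (v != u)) (off v.+1 - off v + 1).
      by apply: eq_bigl => v; rewrite mem_rcons inE negb_or andbC.
    by case: ifP => _; lia.
  exists Q, h.+1, (nvar st2 7); split=> //; split=> //.
    move=> i v; rewrite ltnS leq_eqVlt => /orP[/eqP->|]; last exact: cl.
    rewrite -/u => euv tight; have [i' [hi' nbi wti]] := arc_index euv.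
    by apply: jcl nbi _; rewrite ?jE ?wti.
  move=> hq; rewrite eo2 // leqnn off_mono //; split=> // i v /andP[i0 i1].
  by have := leq_ltn_trans i0 i1; rewrite ltnn.
have [y [nby euy wty]] := arcs (x := u) (j := j) ltac:(lia).
rewrite crun_seqs; set st2 := crun st1 _.
have e9 : nvar st2 9 = y.
  rewrite -[nvar st2 9]/(narr st1 0 (nvar st1 1 + 4 + nvar st1 7)).
  by rewrite (in_n (pt_input pt1)) e7 (in_nb (pt_input pt1)) // (@off_lt u) //; lia.
have e8 : nvar st2 8 = u by exact: eu.
have {}e7 : nvar st2 7 = j by exact: e7.
have {}e5 : nvar st2 5 = h by exact: e5.
have pt2 : partial_tree Q st2.
  by apply: partial_tree_frame pt1 _ _ _ _ => // i i7; rewrite /= upd_neq // neq_ltn (leq_trans i7).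
have wtj : rarr st2 j = w u y by rewrite (in_wt (pt_input pt2)) // (@off_lt u) //; lia.
move: st2 e9 e8 e7 e5 pt2 wtj => st2 e9 e8 e7 e5 pt2 wtj {st1 eu pt1 offE}.
(* Common end of the three outcomes for the arc: head already visited, arc not tight, or head
   appended to the queue. In each, the arc is settled and its index may advance. *)
suff done Q' st3 : partial_tree Q' st3 -> nvar st3 5 = h -> nvar st3 7 = j ->
    (exists Z, Q' = Q ++ Z) -> uniq Q' -> (y \in Q' \/ (d y < d u + w u y)%R) ->
    let st4 := crun st3 (NAssign 7 (esucc (EVar 7))) in
    exists2 k', k' < work Q h j & exists Q h j,
    [/\ partial_tree Q st4, closed_upto Q h j, nvar st4 5 = h, nvar st4 7 = j & k' = work Q h j].
  have same : y \in Q \/ (d y < d u + w u y)%R ->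
      exists2 k', k' < work Q h j & exists Q h j, let st4 := crun st2 (NAssign 7 (esucc (EVar 7))) in
      [/\ partial_tree Q st4, closed_upto Q h j, nvar st4 5 = h, nvar st4 7 = j & k' = work Q h j].
    by apply: done => //; exists [::]; rewrite cats0.
  rewrite !crun_seqs crun_nil crun_ifN [neval _ _]/= [neval _ (EConst 0)]/= e9.
  have [yQ|yQ] := boolP (y \in Q).
    by rewrite leqNgt (pt_dep_gt0 pt2 yQ); apply: same; left.
  rewrite (pt_fresh pt2 yQ) leqnn crun_ifR [reval _ (RSum _ _)]/= e7 wtj.
  rewrite (dE_eval (v := u) (pt_input pt2)) // (dE_eval (v := y) (pt_input pt2)) //.
  case: ifPn => [tight|]; last by rewrite -real_ltNge ?num_real // => ?; apply: same; right.
  have pt3 := visit_ok pt2 e8 e9 uin yQ rQ euy tight.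
  have [[en _] _ _ _ _] := visit_store pt2 e8 e9.
  apply: done pt3 _ _ _ _ _.
  - by rewrite en upd_neq.
  - by rewrite en upd_neq.
  - by exists [:: y]; rewrite cats1.
  - by rewrite rcons_uniq yQ.
  - by left; rewrite mem_rcons mem_head.
move=> pt3 f5 f7 [Z Q'E] uQ' yQ'; set st4 := crun _ _.
have hQ' : h < size Q' by rewrite Q'E size_cat ltn_addr.
have uE : nth root Q' h = u by rewrite Q'E nth_cat hlt.
have sub : {subset Q <= Q'} by move=> v vQ; rewrite Q'E mem_cat vQ.
exists (work Q' h j.+1).
  have tE : take h Q' = take h Q by rewrite Q'E takel_cat // ltnW.
  rewrite /work tE uE hlt hQ' -/u sumE.
  by move: (\sum_(v : 'I_n | _) _) => S; clear -j0 jlt; lia.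
exists Q', h, j.+1; split=> //=.
- by apply: partial_tree_frame pt3 _ _ _ _ => // i i7; rewrite /= upd_neq // neq_ltn (leq_trans i7).
- split=> // [|||hh].
  + exact: sub.
  + exact: ltnW.
  + move=> i v ih; rewrite Q'E nth_cat (ltn_trans ih hlt) -Q'E => euv tight.
    by apply: sub; apply: cl tight.
  + rewrite uE; split; first by rewrite (leqW j0) -addn1.
    move=> i v /andP[i0 i1] nbi tight.
    have [ij|ij] := eqVneq i j; last first.
      by apply: sub; apply: jcl nbi tight; rewrite i0 ltn_neqAle ij -ltnS.
    subst i; have vy : v = y by apply: val_inj; rewrite -nbi nby.
    by case: yQ' => [|]; rewrite vy // in tight *; rewrite wty in tight; lra.
- by rewrite -[RHS]addn1 -f7.
Qed.

Lemma search_init_ok st : input st -> (forall v, narr st dep v = 0) ->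
  (forall k, k \notin [:: 7; par; lab; dep] -> narr st k = narr st0 k) ->
  exists2 k, k <= off n + n & exists Q h j, let st' := crun st (search_init rootv lab dep) in
  [/\ partial_tree Q st', closed_upto Q h j, nvar st' 5 = h, nvar st' 7 = j & k = work Q h j].
Proof.
move=> it fresh frame.
have [[f1 f2 f3 f4] [f5 f6 f7] [f8 f9 f10]] := arrays_neq.
have g1 : (par == 7) = false by rewrite eq_sym.
have g2 : (lab == 7) = false by rewrite eq_sym.
have g3 : (dep == 7) = false by rewrite eq_sym.
have g6 : (dep == lab) = false by rewrite eq_sym.
have rE := rootvE it.
exists (work [:: root] 0 (off root)).
  rewrite /work /= subnn subn0.
  rewrite (eq_bigl xpredT) //.
  rewrite big_split /= sum1_card card_ord leq_add2r.
  rewrite -(big_mkord xpredT (fun i => off i.+1 - off i)) telescope_sumn ?off0 ?subn0 //.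
exists [:: root], 0, (off root).
set st' := crun _ _.
have h7 : nvar st' 7 = off root.
  have r5 : (rootv == 6) = false by apply/eqP; lia.
  have r6 : (rootv == 5) = false by apply/eqP; lia.
  by rewrite /st' /= !(updE, f1, f3, f4, r5, r6, rE) /= (in_off it) // ltnW.
have hd : narr st' dep = upd (narr st dep) root 1.
  by rewrite /st' /= !(updE, eqxx, f7, g3, g6, f10) /= rE.
have hl : narr st' lab = upd (narr st lab) root root.
  by rewrite /st' /= !(updE, eqxx, f6, g2, g6, f10) /= rE.
have hq : narr st' 7 = upd (narr st 7) 0 root.
  by rewrite /st' /= !(updE, eqxx, f6, f7) /= rE.
have hk k : k \notin [:: 7; par; lab; dep] -> narr st' k = narr st k.
  rewrite !inE !negb_or => /and4P[/negbTE k1 /negbTE k2 /negbTE k3 /negbTE k4].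
  by rewrite /st' /= /upd k1 k3 k4.
have hn i : 0 < i < 5 -> nvar st' i = nvar st i by move=> hi; rewrite /= !upd_neq //; lia.
have h5 : nvar st' 5 = 0 by [].
have h6 : nvar st' 6 = 1 by [].
have hr : rvar st' = rvar st by [].
have hx : rarr st' = rarr st by [].
move: st' h7 hd hl hq hk hn h5 h6 hr hx => st' h7 hd hl hq hk hn h5 h6 hr hx.
split=> //.
- split=> //.
  + by apply: input_frame it; rewrite ?hr ?hx // hk // !inE f2 f3 f4.
  + by move=> [|i] // _; rewrite hq upd_eq.
  + move=> v; rewrite inE => vr; rewrite hd upd_neq //.
  + by move=> v; rewrite inE => /eqP->; rewrite hd upd_eq.
  + by move=> v; rewrite inE => /eqP->; rewrite hl upd_eq.
  + by rewrite hd hl !upd_eq.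
  + by move=> v; rewrite inE => /eqP->; rewrite eqxx.
  + by move=> k kk; rewrite hk // frame.
- split=> //; first by rewrite inE eqxx.
  by move=> _ /=; rewrite leqnn off_mono //; split=> // i v; lia.
Qed.

Definition tree_found a := exists P L D,
  tight_tree e w inV root d P L D /\ tree_rep a par lab dep root P L D.

Lemma search_exit_ok Q st h j : partial_tree Q st -> closed_upto Q h j -> size Q <= h ->
  tree_found (narr st).
Proof.
move=> pt [uQ rQ hQ cl _] Qh.
have hE : h = size Q by apply/eqP; rewrite eqn_leq hQ.
(* A missing vertex of least distance has a strictly nearer tight predecessor. That one is in [Q]
   and fully processed, so the vertex would have been queued. *)
have full v : v \in Q.
  apply/negPn/negP => vQ.
  have [x xQ xmin] := @arg_minP _ R _ v (fun x => x \notin Q) d vQ.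
  have xr : x != root by apply: contraNneq xQ => ->.
  have [u eux tight] := dist_tight_pred w_gt0 d_dist xr.
  have uQ' : u \in Q.
    apply/negPn/negP => /xmin; have := w_gt0 eux; lra.
  move/negP: xQ; apply; apply: (cl (index u Q)); rewrite ?nth_index //.
  by rewrite hE index_mem.
have [k1 k2 k3 k4 k5 k6 [k7 k7'] k8 k9] := pt.
(* The default of [insubd] can only be reached for the parent of the root, which [tight_tree] leaves
   open. *)
exists (fun v : 'I_n => insubd root (narr st par v)),
  (fun v : 'I_n => insubd root (narr st lab v)), (fun v : 'I_n => narr st dep v).
split; last first.
  split=> // v => [vr|]; last by rewrite val_insubd k6.
  by have [u [_ _ -> _ _]] := k8 v (full v) vr; rewrite valKd.
split=> // [v|v vr|v vr|v vr|v iv|v iv].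
- exact: k5.
- by have [u [_ _ -> -> _]] := k8 v (full v) vr; rewrite valKd.
- by have [u [_ [eu _] -> _ _]] := k8 v (full v) vr; rewrite valKd.
- by have [u [_ [_ tu] -> _ _]] := k8 v (full v) vr; rewrite valKd.
- have [->|vr] := eqVneq v root; first by rewrite k7' valKd.
  by have [u [_ _ _ _ ->]] := k8 v (full v) vr; rewrite iv valKd.
- have vr : v != root by apply: contraNneq iv => ->.
  by have [u [_ _ -> _ ->]] := k8 v (full v) vr; rewrite (negbTE iv) valKd.
Qed.

End Search.

(** [K] carries facts about arrays that the search does not touch: the zeroed depths awaiting the
    second search, then the finished first tree. *)
Lemma search_triple B (root : 'I_n) d rootv par lab dep dE (K : (nat -> nat -> nat) -> Prop) :
  (forall v, is_dist e w root v (d v)) -> (forall x y, e x y -> (0 < w x y)%R) -> inV root ->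
  0 < rootv < 5 -> (forall st, input st -> nvar st rootv = root) ->
  (forall st a (v : 'I_n), input st -> neval st a = v -> reval st (dE a) = d v) ->
  uniq [:: 0; 7; par; lab; dep] -> all swf (search rootv dE par lab dep) ->
  (forall a a', (forall k, k \notin [:: 7; par; lab; dep] -> a' k = a k) -> K a -> K a') ->
  off n + n <= B ->
  triple B (search rootv dE par lab dep)
    (fun st => [/\ input st, forall v, narr st dep v = 0 & K (narr st)])
    (fun st => [/\ input st, tree_found root d par lab dep (narr st) & K (narr st)]).
Proof.
move=> d_dist w_gt0 rV rb rE dEe au /and3P[wf1 wf2 _] KE nB A P l m s0 code sm [it fr Ks].
pose I st k := exists Q h j, [/\ partial_tree root d par lab dep s0 Q st, closed_upto root d Q h j,
  nvar st 5 = h, nvar st 7 = j & k = work root Q h j].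
have t1 : triple B [:: Block (search_init rootv lab dep)] (fun st => st = s0)
    (fun st => exists2 k, k <= B & I st k).
  apply: triple_block => // _ ->.
  have [k kB Ik] := @search_init_ok root d rootv par lab dep rV rb rE au s0 s0 it fr (fun _ _ => erefl).
  by exists k => //; apply: leq_trans nB.
have t2 := @triple_loop R _ _ _ I B wf2 (search_body_ok rV rb dEe au (st0 := s0)).
have [st [[k [Q [h [j [pt cl eh _ _]]]]] ex] E] := triple_seq t1 t2 code sm erefl.
exists st => //; split; first exact: pt_input pt.
  apply: (search_exit_ok _ _ _ pt cl) => //.
  by move: ex; rewrite /= eh (pt_tail pt) addn1.
by apply: KE Ks => k' hk; rewrite (pt_frame pt).
Qed.

(** * Selecting the best candidate and writing its path *)

Section Select.
Hypothesis w_sym : forall x y, e x y -> w x y = w y x.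
Hypothesis e_sym : symmetric e.
Hypothesis w_gt0 : forall x y, e x y -> (0 < w x y)%R.
Hypothesis ds_dist : forall v, is_dist e w s v (ds v).
Hypothesis dt_dist : forall v, is_dist e w t v (dt v).
Variables (ps ls pt lt : 'I_n -> 'I_n) (dps dpt : 'I_n -> nat).
Hypothesis tree_s : tight_tree e w inV s ds ps ls dps.
Hypothesis tree_t : tight_tree e w inV t dt pt lt dpt.

Definition trees_stored (a : nat -> nat -> nat) :=
  tree_rep a 1 2 3 s ps ls dps /\ tree_rep a 4 5 6 t pt lt dpt.

Notation cand := (candidate e w t ds dt ls lt).
Notation cval := (cand_val w ds dt).

Definition seen v j (x y : 'I_n) := exists i,
  [/\ off x <= i < off x.+1, nb i = y & x < v \/ x = v :> nat /\ i < j].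

Definition best_of (S : 'I_n -> 'I_n -> Prop) st :=
  if nvar st 10 == 0 then forall x y, S x y -> ~~ cand x y
  else exists x y : 'I_n, [/\ nvar st 11 = x, nvar st 12 = y, cand x y, rvar st 2 = cval x y
    & forall x' y', S x' y' -> cand x' y' -> (cval x y <= cval x' y')%R].

Lemma best_of_ext (S S' : 'I_n -> 'I_n -> Prop) st st' : (forall x y, S' x y -> S x y) ->
  (forall i, 9 < i < 13 -> nvar st' i = nvar st i) -> rvar st' = rvar st ->
  best_of S st -> best_of S' st'.
Proof.
move=> SS en er; rewrite /best_of er !en //; case: eqP => [_ h x y /SS/h //|_].
by move=> [x [y [ex ey c ev mn]]]; exists x, y; split=> // x' y' /SS/mn.
Qed.

Definition select_test : cmd :=
  IfN (ediff (EIdx 2 (EVar 9)) (EIdx 5 (EVar 8))) (EConst 0) Skip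
  (IfR (ecand (EVar 9) (EVar 8)) (RVar 1) Skip
  (IfR (ecand (EVar 8) (EVar 9)) (RVar 1) Skip
  (IfN (EVar 10) (EConst 0) keep
  (IfR (RVar 2) (ecand (EVar 9) (EVar 8)) Skip keep)))).

Lemma select_test_run st j (x y : 'I_n) : input st -> trees_stored (narr st) ->
  nvar st 7 = j -> nvar st 8 = y -> nvar st 9 = x -> j < off n -> wt j = w x y -> e x y ->
  crun st select_test =
    if cand x y && ((nvar st 10 == 0) || (cval x y < rvar st 2)%R) then crun st keep else st.
Proof.
move=> it [[_ h2 _] [_ h5 _]] e7 e8 e9 jn wj exy.
rewrite /select_test crun_ifN !crun_ifR crun_ifN crun_ifR.
have -> : neval st (ediff (EIdx 2 (EVar 9)) (EIdx 5 (EVar 8))) = ls x - lt y + (lt y - ls x).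
  by rewrite /= e8 e9 h2 h5.
have -> : reval st (ecand (EVar 9) (EVar 8)) = cval x y.
  by rewrite /= e7 e8 e9 (in_m it) (in_n it) (in_ds it) (in_dt it) (in_wt it) // wj.
have -> : reval st (ecand (EVar 8) (EVar 9)) = (ds y + w x y + dt x)%R.
  by rewrite /= e7 e8 e9 (in_m it) (in_n it) (in_ds it) (in_dt it) (in_wt it) // wj.
rewrite [reval _ _]/= [neval _ (EVar _)]/= [neval _ (EConst _)]/= (in_dst it) /candidate exy /offD /=.
have -> : (ls x - lt y + (lt y - ls x) <= 0) = (ls x == lt y).
  by rewrite -val_eqE /=; apply/idP/eqP => [|->]; lia.
rewrite leqn0.
case: (ls x == lt y); first by rewrite andbF.
rewrite (leNgt (cval x y)) (leNgt (ds y + w x y + dt x)%R) -[(ds x + w x y + dt y)%R]/(cval x y).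
case: (ds t < cval x y)%R => //=.
case: (ds t < _)%R => //=.
case: (nvar st 10 == 0) => //=.
by rewrite leNgt; case: (cval x y < rvar st 2)%R.
Qed.

Lemma select_body_eq : select_body =
  IfN (esucc (EVar 7)) (eoff (esucc (EVar 9)))
    (seqs [:: NAssign 8 (enbr (EVar 7)); select_test; NAssign 7 (esucc (EVar 7))])
    (NAssign 9 (esucc (EVar 9))).
Proof. by []. Qed.

Definition selecting st k := exists v j, [/\ input st, trees_stored (narr st),
  [/\ nvar st 9 = v, nvar st 7 = j & v <= n], v < n -> off v <= j <= off v.+1
  & best_of (seen v j) st /\ k = (off n - j) + (n - v)].

Lemma select_body_ok st k : selecting st k ->
  neval st (esucc (EVar 9)) <= neval st (EVar 1) ->
  exists2 k', k' < k & selecting (crun st select_body) k'.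
Proof.
move=> [v [j [it tr [e9 e7 vn] jv [best ->]]]].
rewrite [neval _ _]/= [neval _ (EVar _)]/= e9 (in_n it) addn1 => vlt.
have /andP[j0 j1] := jv vlt.
rewrite select_body_eq crun_ifN.
have -> : neval st (esucc (EVar 7)) = j.+1 by rewrite /= e7 addn1.
have -> : neval st (eoff (esucc (EVar 9))) = off v.+1 by rewrite /= e9 addn1 (in_off it).
pose x := Ordinal vlt.
case: ifPn => [jlt|]; last first.
  rewrite -leqNgt => jge; have jE : j = off v.+1 by apply/eqP; rewrite eqn_leq j1.
  exists ((off n - j) + (n - v.+1)); first by rewrite ltn_add2l ltn_sub2l.
  exists v.+1, j; split=> //.
  - by apply: input_frame it => // i hi; rewrite /= upd_neq //; lia.
  - by rewrite /= upd_eq e9 addn1.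
  - by move=> _; rewrite jE leqnn off_mono.
  split=> //; apply: best_of_ext best => //; last first.
    by move=> i hi; rewrite /= upd_neq //; lia.
  move=> x' y' [i [hi nbi]]; rewrite ltnS leq_eqVlt => hx.
  exists i; split=> //; case: hx => [/orP[/eqP xv|xv]|[xv ij]]; [right | by left | ].
    by split=> //; rewrite jE -xv; case/andP: hi.
  by move: hi; rewrite xv; have := off_mono (leqnSn v.+1); rewrite -jE => ? /andP[? ?]; lia.
have [y [nby exy wj]] := arcs (x := x) (j := j) ltac:(by rewrite j0).
have jn : j < off n by apply: (@off_lt x).
rewrite !crun_seqs crun_nil; set st1 := crun st (NAssign 8 _).
have it1 : input st1 by apply: input_frame it => // i hi; rewrite /= upd_neq //; lia.
have e8 : nvar st1 8 = y.
  rewrite -[nvar st1 8]/(narr st 0 (nvar st 1 + 4 + nvar st 7)) (in_n it) e7.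
  by rewrite (in_nb it) // nby.
rewrite (select_test_run (x := x) it1 tr e7 e8 e9 jn wj exy).
have best1 : best_of (seen v j) st1.
  by apply: best_of_ext best => // i hi; rewrite /= upd_neq //; lia.
have tr1 : trees_stored (narr st1) by [].
have {}e9 : nvar st1 9 = x by [].
have {}e7 : nvar st1 7 = j by [].
move: st1 it1 tr1 e8 e9 e7 best1 => st1 it1 tr1 e8 e9 e7 best1 {st it tr best}.
(* Advancing the index by one adds at most the arc just tested, so the minimum has to be compared
   with that arc only. *)
have seenS x' y' : seen v j.+1 x' y' -> seen v j x' y' \/ (x' = x /\ y' = y).
  move=> [i [hi nbi [xv|[xv]]]]; first by left; exists i; split=> //; left.
  rewrite ltnS leq_eqVlt => /orP[/eqP ij|ij].
    by right; split; apply: val_inj => //=; rewrite -nbi ij.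
  by left; exists i; split=> //; right.
exists ((off n - j.+1) + (n - v)); first by rewrite ltn_add2r ltn_sub2l.
exists v, j.+1.
case: ifPn => [/andP[cxy better]|nbetter].
  split=> //.
  - by apply: input_frame it1 => // i hi; rewrite /= !upd_neq //; lia.
  - by split=> //; rewrite -[RHS]addn1 -e7.
  - by move=> _; rewrite (leqW j0).
  split=> //; rewrite /best_of.
  set st2 := crun _ _; have -> : nvar st2 10 = 1 by [].
  exists x, y; split=> //.
    rewrite -[rvar st2 2]/(reval st1 (ecand (EVar 9) (EVar 8))) /= e7 e8 e9.
    by rewrite (in_m it1) (in_n it1) (in_ds it1) (in_dt it1) (in_wt it1) // wj.
  move=> x' y' /seenS[sx c|[-> ->] //].
  move: best1; rewrite /best_of; case: eqP better => [_ _ h|_ /= lt0 [x0 [y0 [_ _ _ E mn]]]].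
    by have := h _ _ sx; rewrite c.
  by rewrite E in lt0; apply: le_trans (ltW lt0) (mn _ _ sx c).
split=> //.
- by apply: input_frame it1 => // i hi; rewrite /= !upd_neq //; lia.
- by split=> //; rewrite -[RHS]addn1 -e7.
- by move=> _; rewrite (leqW j0).
split=> //; rewrite /best_of.
set st2 := crun _ _.
have -> : nvar st2 10 = nvar st1 10 by [].
have -> : nvar st2 11 = nvar st1 11 by [].
have -> : nvar st2 12 = nvar st1 12 by [].
have -> : rvar st2 = rvar st1 by [].
move: best1 nbetter; rewrite /best_of; case: eqP => [_ h|_ [x0 [y0 [h1 h2 h3 h4 mn]]]] /=.
  by rewrite andbT => ncxy x' y' /seenS[/h//|[-> ->]].
rewrite h4 negb_and -leNgt => nb'; exists x0, y0; split=> // x' y' /seenS[/mn//|[-> ->]] c.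
by move: nb'; rewrite c.
Qed.

Definition chosen st :=
  if nvar st 10 == 0 then forall x y, ~~ cand x y
  else exists x y : 'I_n, [/\ nvar st 11 = x, nvar st 12 = y, cand x y
    & forall x' y', cand x' y' -> (cval x y <= cval x' y')%R].

Lemma select_triple B : off n + n <= B ->
  triple B [:: Block select_init; Loop (esucc (EVar 9)) (EVar 1) select_body]
    (fun st => input st /\ trees_stored (narr st)) (fun st => trees_stored (narr st) /\ chosen st).
Proof.
move=> nB; apply: (triple_seq (gs1 := [:: _]) (Mid := fun st => exists2 k, k <= B & selecting st k)).
  apply: triple_block => // st [it tr].
  exists (off n + n) => //; exists 0, 0; split=> //; last 1 first.
  - split; last by rewrite !subn0.
    by move=> x y [i [_ _ [|[]]]].
  - by apply: input_frame it => // i hi; rewrite /= !upd_neq //; lia.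
  - by rewrite off0.
apply: triple_impl (triple_loop (I := selecting) _ select_body_ok) _ _ => //.
move=> st [[k [v [j [it tr [e9 e7 vn] _ [best _]]]]]].
rewrite /= e9 (in_n it) addn1 ltnS => nv; split=> //.
have all_seen x y : cand x y -> seen v j x y.
  case/and3P=> /arc_index[i [hi nbi _]] _ _; exists i; split=> //; left.
  exact: leq_trans nv.
move: best; rewrite /best_of /chosen; case: eqP => _.
  by move=> h x y; apply/negP => c; have := h x y (all_seen _ _ c); rewrite c.
move=> [x [y [ex ey c _ mn]]]; exists x, y; split=> // x' y' c'.
exact: mn (all_seen _ _ c') c'.
Qed.

Definition answer st :=
  (narr st 8 0 = 0 /\ forall q, ~ outward e w s t q) \/
  exists q, [/\ opt_outward e w s t q, narr st 8 0 = size q, size q <= n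
    & forall i, i < size q -> narr st 8 i.+1 = nth s q i].

Lemma iter_par (r : 'I_n) d0 par lab dep (v : 'I_n) k : tight_tree e w inV r d0 par lab dep ->
  k < dep v -> dep (iter k par v) = dep v - k.
Proof.
move=> tr; elim: k => [|k IH] hk; first by rewrite subn0.
have := IH (ltnW hk); have [->|vr] := eqVneq (iter k par v) r.
  by rewrite (dep_root tr); lia.
by rewrite (dep_par tr vr) => E; rewrite iterS; lia.
Qed.

(** [tree_rep] says nothing about the array entry for the parent of the root; this shows when a
    parent that is read can be trusted. *)
Lemma iter_neq_root (r : 'I_n) d0 par lab dep (v : 'I_n) k : tight_tree e w inV r d0 par lab dep ->
  k.+1 < dep v -> iter k par v != r.
Proof.
move=> tr hk; apply/eqP => E; have := iter_par tr (ltnW hk); rewrite E (dep_root tr); lia.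
Qed.

Definition best_choice x y := cand x y /\
  forall x' y', cand x' y' -> (cval x y <= cval x' y')%R.

Definition writing_s st i := nvar st 13 = i /\ trees_stored (narr st) /\
  ([/\ i = 0, nvar st 14 = 0, nvar st 15 = 1, narr st 8 0 = 0 & forall x y, ~~ cand x y] \/
   exists x y : 'I_n, [/\ best_choice x y, i <= dps x,
     [/\ nvar st 12 = y, nvar st 14 = dps x + dpt y, nvar st 15 = (dps x).+1
       & narr st 8 0 = dps x + dpt y],
     0 < i -> nvar st 8 = iter (dps x - i) ps x
     & forall m, i < m <= dps x -> narr st 8 m = iter (dps x - m) ps x]).

Lemma trees_stored_frame a a' : (forall k, k < 8 -> a' k = a k) ->
  trees_stored a -> trees_stored a'.
Proof. by move=> E [[h1 h2 h3] [h4 h5 h6]]; split; split; rewrite E. Qed.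

Lemma output_init_ok st : trees_stored (narr st) -> chosen st ->
  exists2 k, k <= n & writing_s (crun st output_init) k.
Proof.
move=> tr; have [[_ _ d1] [_ _ d2]] := tr; rewrite /chosen.
have -> : crun st output_init = crun (if 1 <= nvar st 10 then crun st
    (seqs [:: NAssign 13 (EConst 0); NAssign 14 (EConst 0); NAssign 13 (EIdx 3 (EVar 11));
      NAssign 8 (EVar 11); NAssign 14 (EAdd (EVar 13) (EIdx 6 (EVar 12)))])
    else crun st (seqs [:: NAssign 13 (EConst 0); NAssign 14 (EConst 0)]))
    (seqs [:: NAssign 15 (esucc (EVar 13)); NWrite 8 (EConst 0) (EVar 14)]) by [].
rewrite lt0n; case: (nvar st 10 == 0) => ch.
  exists 0 => //; split=> //; split; first by apply: trees_stored_frame tr => k hk; rewrite /= upd_neq //; lia.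
  by left.
have [x [y [ex ey c mn]]] := ch.
exists (dps x); first by rewrite -[n in _ <= n]card_ord (dep_card w_gt0 ds_dist tree_s).
set st' := crun _ _.
have e13 : nvar st' 13 = dps x by rewrite -d1 -ex.
have e14 : nvar st' 14 = dps x + dpt y by rewrite -d1 -d2 -ex -ey.
split=> //; split; first by apply: trees_stored_frame tr => k hk; rewrite /= upd_neq //; lia.
right; exists x, y; split=> //; last by move=> m; lia.
  by split=> //; rewrite -[RHS]addn1 -e13.
by move=> _; rewrite subnn /= -ex.
Qed.

Lemma output_s_ok st k : writing_s st k -> neval st (EConst 1) <= neval st (EVar 13) ->
  exists2 k', k' < k & writing_s (crun st output_s) k'.
Proof.
move=> [e13 [tr h]]; rewrite [neval _ _]/= [neval _ (EVar _)]/= e13 => k0.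
case: h => [[E] | [x [y [bc kD [e12 e14 e15 o0] e8 ho]]]]; first by rewrite E in k0.
exists k.-1; first by lia.
set st' := crun _ _.
have e13' : nvar st' 13 = k.-1 by rewrite -subn1 -e13.
have eo : narr st' 8 = upd (narr st 8) k (iter (dps x - k) ps x) by rewrite -e8 // -e13.
have ea j : j < 8 -> narr st' j = narr st j by move=> hj; rewrite /= upd_neq //; lia.
have e8' : nvar st' 8 = narr st 1 (nvar st 8) by [].
split=> //; split; first exact: trees_stored_frame tr.
right; exists x, y; split=> //; first by lia.
- by split=> //; rewrite eo upd_neq //; lia.
- move=> k1; rewrite e8' e8 //; have [[tp _ _] _] := tr.
  rewrite tp; last by apply: (iter_neq_root tree_s); lia.
  by rewrite (_ : dps x - k.-1 = (dps x - k).+1) //; lia.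
move=> m hm; rewrite eo updE; case: eqP => [->//|mk].
by apply: ho; lia.
Qed.

Definition writing_t st k := trees_stored (narr st) /\
  ([/\ nvar st 14 = 0, nvar st 15 = 1, narr st 8 0 = 0 & forall x y, ~~ cand x y] \/
   exists (x y : 'I_n) i, [/\ best_choice x y, nvar st 15 = i,
     [/\ nvar st 14 = dps x + dpt y, narr st 8 0 = dps x + dpt y,
         dps x < i <= (dps x + dpt y).+1 & k = (dps x + dpt y).+1 - i],
     i <= dps x + dpt y -> nvar st 8 = iter (i - (dps x).+1) pt y
     & forall m, 0 < m < i -> narr st 8 m =
         if m <= dps x then iter (dps x - m) ps x else iter (m - (dps x).+1) pt y]).

Lemma output_t_ok st k : writing_t st k -> neval st (EVar 15) <= neval st (EVar 14) ->
  exists2 k', k' < k & writing_t (crun st output_t) k'.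
Proof.
move=> [tr h]; rewrite [neval _ _]/= [neval _ (EVar 14)]/=.
case: h => [[-> ->] //| [x [y [i [bc e15 [e14 o0 hi ->] e8 ho]]]]]; rewrite e15 e14 => ile.
exists ((dps x + dpt y).+1 - i.+1); first by lia.
set st' := crun _ _.
have e15' : nvar st' 15 = i.+1 by rewrite -[RHS]addn1 -e15.
have eo : narr st' 8 = upd (narr st 8) i (iter (i - (dps x).+1) pt y) by rewrite -e8 // -e15.
have ea j : j < 8 -> narr st' j = narr st j by move=> hj; rewrite /= upd_neq //; lia.
have e8' : nvar st' 8 = narr st 4 (nvar st 8) by [].
split; first exact: trees_stored_frame tr.
right; exists x, y, i.+1; split=> //.
- by split=> //; [rewrite eo upd_neq //; lia | lia].
- move=> i1; rewrite e8' e8 //; have [_ [tp _ _]] := tr.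
  rewrite tp; last by apply: (iter_neq_root tree_t); lia.
  by rewrite (_ : i.+1 - (dps x).+1 = (i - (dps x).+1).+1) //; lia.
move=> m hm; rewrite eo updE; case: eqP => [->|mk]; last by apply: ho; lia.
by rewrite leqNgt ifF //; lia.
Qed.

Lemma output_triple B : n + n <= B ->
  triple B [:: Block output_init; Loop (EConst 1) (EVar 13) output_s;
               Block (NAssign 8 (EVar 12)); Loop (EVar 15) (EVar 14) output_t]
    (fun st => trees_stored (narr st) /\ chosen st) answer.
Proof.
move=> nB.
have cardn v : dps v <= n /\ dpt v <= n.
  split; rewrite -[X in _ <= X]card_ord.
    exact: (dep_card w_gt0 ds_dist tree_s).
  exact: (dep_card w_gt0 dt_dist tree_t).
apply: (triple_seq (gs1 := [:: _]) (Mid := fun st => exists2 k, k <= B & writing_s st k)).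
  apply: triple_block => // st [tr ch]; have [k kn ws] := output_init_ok tr ch.
  by exists k => //; lia.
apply: (triple_seq (gs1 := [:: _])).
  exact: (triple_loop (I := writing_s)) output_s_ok.
apply: (triple_seq (gs1 := [:: _]) (Mid := fun st => exists2 k, k <= B & writing_t st k)).
  apply: triple_block => // st [[k [e13 [tr h]]]]; rewrite /= e13 => k0.
  have {}k0 : k = 0 by lia.
  subst k; case: h => [[_ e14 e15 o0 nc]|[x [y [bc _ [e12 e14 e15 o0] _ ho]]]].
    by exists 0 => //; split=> //; left.
  have [h1 h2] := (cardn x, cardn y).
  exists ((dps x + dpt y).+1 - (dps x).+1); first by lia.
  split=> //; right; exists x, y, (dps x).+1; split=> //=.
  - by split=> //; lia.
  - by rewrite subnn /= -e12.
  by move=> m hm; rewrite ho; [case: ifP; lia | lia].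
apply: triple_impl (triple_loop (I := writing_t) _ output_t_ok) _ _ => //.
move=> st [[k [tr h]]] /=; case: h => [[_ _ o0 nc] _|].
  left; split=> // q /(outward_candidate e_sym w_sym w_gt0 ds_dist dt_dist tree_s tree_t)[a [b [c _]]].
  by have := nc a b; rewrite c.
move=> [x [y [i [[c mn] e15 [e14 o0 hi _] _ ho]]]]; rewrite e15 e14 => iE.
right; exists (best_path ps pt dps dpt x y).
have sz : size (best_path ps pt dps dpt x y) = dps x + dpt y.
  by rewrite size_cat size_rev !size_traject.
have opt := best_path_opt e_sym w_sym w_gt0 ds_dist dt_dist tree_s tree_t c mn.
(* Each depth is at most [n], which bounds the sum only by twice that; the sharper bound comes from
   simplicity of the joined path. *)
have szn : size (best_path ps pt dps dpt x y) <= n.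
  case: (opt) => -[/stpathP[p -> [_ _ /card_uniqP u]] _] _.
  by rewrite -[n in _ <= n]card_ord -u max_card.
rewrite sz in szn; split; rewrite ?sz // => m hm; rewrite ho; last by lia.
rewrite nth_cat size_rev size_traject.
case: ifP => mD.
  by rewrite nth_rev size_traject // (set_nth_default x) ?nth_traject ?size_traject //; lia.
by rewrite subSS (set_nth_default y) ?nth_traject ?size_traject //; lia.
Qed.

End Select.

Lemma algorithm_triple B : symmetric e ->
  (forall x y, e x y -> w x y = w y x) -> (forall x y, e x y -> (0 < w x y)%R) ->
  (forall v, is_dist e w s v (ds v)) -> (forall v, is_dist e w t v (dt v)) ->
  off n + n + n <= B ->
  triple B algorithm (fun st => input (crun st setup) /\ forall k v, 0 < k < 16 -> narr st k v = 0)
    answer.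
Proof.
move=> e_sym w_sym w_gt0 ds_dist dt_dist nB.
have sV := onD_s e_sym w_sym w_gt0 ds_dist dt_dist.
have tV := onD_t ds w_gt0 dt_dist.
pose K1 (a : nat -> nat -> nat) := forall v, a 6 v = 0.
pose found_s := tree_found s ds 1 2 3.
apply: (triple_seq (gs1 := [:: _])
  (Mid := fun st => [/\ input st, forall v, narr st 3 v = 0 & K1 (narr st)])).
  apply: triple_block => // st [it z]; split=> // v; exact: z.
apply: (triple_seq (Mid := fun st => [/\ input st, forall v, narr st 6 v = 0 & found_s (narr st)])).
  apply: triple_impl (search_triple (B := B) (K := K1) ds_dist w_gt0 sV (rootv := 2) _ _ _ _ _ _ _) _ _ => //.
  - by move=> st it; apply: in_s.
  - by move=> st a v it /= ->; rewrite (in_m it) (in_ds it).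
  - by move=> a a' E h v; rewrite E.
  - by lia.
  by move=> st [it fs z]; split.
apply: (triple_seq (Mid := fun st => [/\ input st, tree_found t dt 4 5 6 (narr st) & found_s (narr st)])).
  apply: search_triple => //.
  - by move=> st it; apply: in_t.
  - by move=> st a v it /= ->; rewrite (in_m it) (in_n it) (in_dt it).
  - move=> a a' E [P [L [D [tr [h1 h2 h3]]]]]; exists P, L, D; split=> //.
    by split; rewrite E.
  - by lia.
(* The trees are known only to exist in the current store, so the triple is unfolded to name them
   before the remaining stages are instantiated with them. *)
move=> A P l m st code sm [it [pt [lt [dpt [tt rt]]]] [ps [ls [dps [ts rs]]]]].
have nB1 : off n + n <= B by lia.
have nB2 : n + n <= B by lia.
have tail := triple_seq (@select_triple ps ls pt lt dps dpt B nB1)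
  (output_triple w_sym e_sym w_gt0 ds_dist dt_dist ts tt nB2).
exact: tail A P l m st code sm (conj it (conj rs rt)).
Qed.

End Verification.

(** * The input encoding *)

Section Encoding.
Variables (R : realType) (n : nat) (e : rel 'I_n) (w : 'I_n -> 'I_n -> R).
Variables (s t : 'I_n) (ds dt : 'I_n -> R) (adj : 'I_n -> seq 'I_n).
Hypothesis e_irr : irreflexive e.
Hypothesis e_sym : symmetric e.
Hypothesis adj_spec : forall v, uniq (adj v) /\ (forall u, (u \in adj v) = e v u).
Local Open Scope nat_scope.

Let degs := [seq size (adj v) | v <- enum 'I_n].
Let neighbours := flatten [seq map val (adj v) | v <- enum 'I_n].
Let weights := flatten [seq [seq w v u | u <- adj v] | v <- enum 'I_n].

Definition offset i := sumn (take i degs).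
Definition neighbour j := nth 0 neighbours j.
Definition weight j := nth 0%R weights j.

Lemma size_degs : size degs = n.
Proof. by rewrite size_map size_enum_ord. Qed.

Lemma offset_n : offset n = sumn degs.
Proof. by rewrite /offset take_oversize // size_degs. Qed.

Lemma offset0 : offset 0 = 0.
Proof. by rewrite /offset take0. Qed.

Lemma offset_mono : {homo offset : i j / i <= j}.
Proof.
move=> i j ij; rewrite /offset -(take_takel _ ij).
by rewrite -[X in _ <= sumn X](cat_take_drop i (take j degs)) sumn_cat leq_addr.
Qed.

Lemma offsetS (v : 'I_n) : offset v.+1 = offset v + size (adj v).
Proof.
rewrite /offset (take_nth 0) ?size_degs // sumn_rcons (nth_map v) ?size_enum_ord //.
by rewrite nth_ord_enum.
Qed.

Lemma nth_flatten_take (T : Type) (x0 : T) (ss : seq (seq T)) r c :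
  c < size (nth [::] ss r) -> nth x0 (flatten ss) (sumn (take r (shape ss)) + c) = nth x0 (nth [::] ss r) c.
Proof.
move=> hc; have hc' : c < nth 0 (shape ss) r.
  by rewrite /shape (nth_map [::]) //; apply: contraTltn hc => h; rewrite nth_default.
by rewrite nth_flatten -/(flatten_index _ _ _) flatten_indexKl // flatten_indexKr.
Qed.

Lemma shape_neighbours : shape [seq map val (adj v) | v <- enum 'I_n] = degs.
Proof. by rewrite /shape -map_comp; apply: eq_map => v /=; rewrite size_map. Qed.

Lemma shape_weights : shape [seq [seq w v u | u <- adj v] | v <- enum 'I_n] = degs.
Proof. by rewrite /shape -map_comp; apply: eq_map => v /=; rewrite size_map. Qed.

Lemma neighbourE (v : 'I_n) k : k < size (adj v) -> neighbour (offset v + k) = nth v (adj v) k.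
Proof.
move=> hk; rewrite /neighbour /neighbours /offset -shape_neighbours nth_flatten_take;
  rewrite (nth_map v) ?size_enum_ord // nth_ord_enum ?size_map //.
by rewrite (nth_map v).
Qed.

Lemma weightE (v : 'I_n) k : k < size (adj v) -> weight (offset v + k) = w v (nth v (adj v) k).
Proof.
move=> hk; rewrite /weight /weights /offset -shape_weights nth_flatten_take;
  rewrite (nth_map v) ?size_enum_ord // nth_ord_enum ?size_map //.
by rewrite (nth_map v).
Qed.

Lemma offset_arcs (x : 'I_n) j : offset x <= j < offset x.+1 ->
  exists y : 'I_n, [/\ neighbour j = y, e x y & weight j = w x y].
Proof.
rewrite offsetS => hj; have hk : j - offset x < size (adj x) by lia.
have -> : j = offset x + (j - offset x) by lia.
exists (nth x (adj x) (j - offset x)); rewrite neighbourE // weightE //; split=> //.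
by rewrite -(proj2 (adj_spec x)) mem_nth.
Qed.

Lemma offset_arc_index (x y : 'I_n) : e x y ->
  exists j, [/\ offset x <= j < offset x.+1, neighbour j = y & weight j = w x y].
Proof.
rewrite -(proj2 (adj_spec x)) => yx; exists (offset x + index y (adj x)).
have lt : index y (adj x) < size (adj x) by rewrite index_mem.
by rewrite neighbourE // weightE // nth_index // offsetS leq_addr ltn_add2l.
Qed.

(** Handshake count: the ordered adjacent pairs split by [x < y], exchanging the ends matches the
    two halves, and irreflexivity excludes the diagonal. *)
Lemma offset_nedges : offset n = 2 * nedges e.
Proof.
rewrite offset_n sumnE big_map big_enum /=.
under eq_bigr => v _ do
  rewrite -(card_uniqP (proj1 (adj_spec v))) -sum1_card (eq_bigl _ _ (proj2 (adj_spec v))).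
rewrite (pair_big_dep xpredT (fun x y => e x y)) /= (bigID (fun p : 'I_n * 'I_n => p.1 < p.2)) /=.
rewrite mul2n -addnn /nedges -sum1dep_card; congr (_ + _).
rewrite (reindex_inj (h := fun p : 'I_n * 'I_n => (p.2, p.1))) /=; last by move=> [a b] [c d] [-> ->].
apply: eq_bigl => -[x y] /=; rewrite e_sym -leqNgt leq_eqVlt.
by case: eqVneq => [/val_inj->|]; rewrite ?e_irr.
Qed.

Let innat := [:: n; val s; val t] ++ [seq sumn (take i degs) | i <- iota 0 n.+1] ++ neighbours.
Let inreal := weights ++ [seq ds v | v <- enum 'I_n] ++ [seq dt v | v <- enum 'I_n].

Lemma size_innat : size innat = n + 4 + offset n.
Proof.
rewrite /innat !size_cat size_map size_iota /neighbours size_flatten shape_neighbours offset_n /=.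
by lia.
Qed.

Lemma innat_offset i : i <= n -> nth 0 innat (3 + i) = offset i.
Proof.
move=> hi; rewrite -[LHS]/(nth 0 ([seq sumn (take i degs) | i <- iota 0 n.+1] ++ neighbours) i).
rewrite nth_cat size_map size_iota ltnS hi.
by rewrite (nth_map 0) ?size_iota // nth_iota.
Qed.

Lemma innat_neighbour j : nth 0 innat (n + 4 + j) = neighbour j.
Proof.
rewrite (_ : n + 4 + j = 3 + (n.+1 + j)); last by lia.
rewrite -[LHS]/(nth 0 ([seq sumn (take i degs) | i <- iota 0 n.+1] ++ neighbours) (n.+1 + j)).
by rewrite nth_cat size_map size_iota ltnNge leq_addr /= addKn.
Qed.

Lemma size_weights : size weights = offset n.
Proof. by rewrite /weights size_flatten shape_weights offset_n. Qed.

Lemma inreal_weight j : j < offset n -> nth 0%R inreal j = weight j.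
Proof. by move=> hj; rewrite /inreal nth_cat size_weights hj. Qed.

Lemma inreal_ds (v : 'I_n) : nth 0%R inreal (offset n + v) = ds v.
Proof.
rewrite /inreal nth_cat size_weights ltnNge leq_addr /= addKn nth_cat size_map size_enum_ord ltn_ord.
by rewrite (nth_map v) ?size_enum_ord // nth_ord_enum.
Qed.

Lemma inreal_dt (v : 'I_n) : nth 0%R inreal (offset n + n + v) = dt v.
Proof.
rewrite /inreal -addnA nth_cat size_weights ltnNge leq_addr /= addKn nth_cat size_map size_enum_ord.
rewrite ltnNge leq_addr /= addKn (nth_map v) ?size_enum_ord // nth_ord_enum //.
Qed.

Lemma setup_input A (st : store R) : n + 4 + offset n + n <= A ->
  (forall i, i < A -> narr st 0 i = relocated (nth 0 innat) n i) ->
  (forall i, i < A -> rarr st i = nth 0%R inreal i) ->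
  input s t ds dt offset neighbour weight (crun st setup).
Proof.
move=> hA hn hr.
have hi i : 3 <= i -> i < A -> narr st 0 i = nth 0 innat i.
  by move=> i3 iA; rewrite hn //; case: i i3 {iA} => [|[|[|i]]].
set st' := crun st setup.
have e1 : nvar st' 1 = n.
  by rewrite -[nvar st' 1]/(narr st 0 2 - 3) hn /= ?addnK //; lia.
have e2 : nvar st' 2 = s by rewrite -[nvar st' 2]/(narr st 0 0) hn //; lia.
have e3 : nvar st' 3 = t by rewrite -[nvar st' 3]/(narr st 0 1) hn //; lia.
have e4 : nvar st' 4 = offset n.
  by rewrite -[nvar st' 4]/(narr st 0 (3 + nvar st' 1)) e1 hi ?innat_offset //; lia.
have ea : narr st' = narr st by [].
have er : rarr st' = rarr st by [].
split=> //.
- rewrite -[rvar st' 1]/(rarr st (nvar st' 4 + nvar st' 3)) e4 e3 hr ?inreal_ds //.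
  by have := ltn_ord t; lia.
- by move=> i hin; rewrite ea hi ?innat_offset //; lia.
- by move=> j hj; rewrite ea hi ?innat_neighbour //; lia.
- by move=> j hj; rewrite er hr ?inreal_weight //; lia.
- by move=> v; rewrite er hr ?inreal_ds //; have := ltn_ord v; lia.
- by move=> v; rewrite er hr ?inreal_dt //; have := ltn_ord v; lia.
Qed.

End Encoding.

(** * The assembled program and its running time *)

Definition program : seq instr :=
  let body := stages_code algorithm (size prologue) in
  prologue ++ body ++ epilogue (size prologue + size body).

Theorem theorem2 (R : realType) :
  exists (P : seq instr) (c : nat),
  forall (n : nat) (e : rel 'I_n) (w : 'I_n -> 'I_n -> R) (s t : 'I_n)
         (ds dt : 'I_n -> R) (adj : 'I_n -> seq 'I_n),
    (* simple undirected graph with positive edge lengths *)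
    irreflexive e -> symmetric e ->
    (forall x y, e x y -> w x y = w y x) ->
    (forall x y, e x y -> 0 < w x y) ->
    (* connected *)
    (forall x y, connect e x y) ->
    (* the input: adjacency lists and the distances d_s, d_t *)
    (forall v, uniq (adj v) /\ (forall u, (u \in adj v) = e v u)) ->
    (forall v, is_dist e w s v (ds v)) ->
    (forall v, is_dist e w v t (dt v)) ->
    exists st : mstate R,
      exec P (c * (nedges e + n + 1)) (input_state w s t ds dt adj) = Some st /\
      ((nmem st 0 = 0%N /\ forall q, ~ outward e w s t q) \/
       (exists q, opt_outward e w s t q /\ output_path st = map val q)).
Proof.
pose C := sumn (map cost algorithm).
(* With m edges the stages take at most [C] times 2m + 2n + 1 steps, covered by [2 * C]. The
   prologue, at most 8A = 128 (2m + 2n + 6) steps, and the epilogue, at most 30 + 8n, are covered by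
   1000. *)
exists program, (2 * C + 1000)%N.
move=> n e w s t ds dt adj e_irr e_sym w_sym w_gt0 _ adj_spec ds_dist dt_dist'.
have dt_dist v : is_dist e w t v (dt v) by apply: is_dist_sym (dt_dist' v).
have off_e := offset_nedges e_irr e_sym adj_spec.
rewrite /input_state; set N := (Z in MState _ Z _); set X := (Z in MState _ _ Z).
have n_gt0 : (0 < n)%N by apply: leq_trans (ltn_ord s).
set M := offset adj n in off_e; pose A := (16 * (M + 2 * (n + 3)))%N.
have N3 : N 3 = 0%N by rewrite /N (innat_offset s t adj (i := 0)) // offset0.
have NM : N (n + 3)%N = M by rewrite addnC /N innat_offset.
have Nout i : (A <= i)%N -> N i = 0%N.
  by move=> hi; rewrite /N nth_default // size_innat -/M; lia.
have code : code_at program 0 program by move=> i _; rewrite add0n.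
have [code1 /code_at_cat[code2 code3]] := @code_at_cat program 0 prologue _ code.
rewrite add0n in code2 code3.
have [k1 [m1 [st1 [k1le r1 sm1 [a0 az x0]]]]] :=
  prologue_ok X n_gt0 (erefl : N 0 = n) N3 NM (erefl A) Nout code1.
have it : input s t ds dt (offset adj) (neighbour adj) (weight w adj) (crun st1 setup).
  by apply: setup_input a0 x0; rewrite -/M; lia.
have tr := algorithm_triple (offset0 adj) (@offset_mono _ adj) (offset_arcs w adj_spec)
  (offset_arc_index w adj_spec) e_sym w_sym w_gt0 ds_dist dt_dist (leqnn (M + n + n)%N).
have [st2 ans [k2 [m2 [k2le r2 sm2]]]] := tr _ _ _ _ _ code2 sm1 (conj it (fun k v => az k v)).
have outn : (narr st2 8 0 <= n)%N by case: ans => [[->//]|[q [_ -> ->]]].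
have [|k3 [m3 [k3le r3 out]]] := epilogue_ok sm2 (erefl _) _ code3; first by lia.
exists (at_ (size prologue + size (stages_code algorithm (size prologue)) +
  size (epilogue (size prologue + size (stages_code algorithm (size prologue))))) m3).
split.
  apply: (runs_exec (runs_trans r1 (runs_trans r2 r3))).
    by rewrite nth_default // /program !size_cat addnA.
  by rewrite -/C in k2le; move: C k2le => C k2le; nia.
have out0 : nmem (at_ 0 m3) 0 = narr st2 8 0 by rewrite /= out.
case: ans => [[z nq]|[q [opt zq _ hq]]]; [left | right].
  by split=> //; rewrite /= out // z.
exists q; split=> //; rewrite /output_path /= out // zq.
apply: (@eq_from_nth _ 0%N) => [|i]; first by rewrite !size_map size_iota.
rewrite size_map size_iota => hi; rewrite (nth_map 0%N) ?size_iota // nth_iota // add0n.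
by rewrite (nth_map s) // out ?zq // hq.
Qed.
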